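(* Let $(E,g,\rho)$ be a Courant vector bundle over $M$ with surjective anchor $\rho:E\to TM$. Then $(E,g,\rho)$ has a restricted Courant algebroid structure if and only if it is a Whitney sum $E=P\oplus C$, given by a splitting as described in the context (with $P=\mathrm{im}\,\partial\oplus Q$), of a Courant subalgebroid $P$ with neutral metric (i.e., $(P,g|_P,\rho|_P)$ carries a Courant algebroid bracket) and a flat pseudo-Euclidean bundle $C$ (i.e., $(C,g|_C)$ admits a flat metric connection).
   Context: Everything is $C^\infty$; $\Gamma$ denotes global cross sections; brackets are $\mathbb{R}$-bilinear. A pseudo-Euclidean vector bundle $(E\to M,g)$ is a real vector bundle with a symmetric, non-degenerate fiber inner product $g$. For a morphism $\rho:E\to TM$, $\partial:T^*M\to E$ is $\partial=\frac12\sharp_g\circ{}^t\rho$ and $\partial f=\partial(df)$, i.e. $g(\partial f,e)=\frac12(\rho e)f$. A Courant vector bundle is $(E,g,\rho)$ with $\mathrm{im}\,\rho$ a (generalized) foliation and $\mathrm{im}\,\partial$ $g$-isotropic (equivalently $\rho\circ\partial=0$). A (skew-symmetric) Courant algebroid structure on $(E,g,\rho)$ is a skew-symmetric bracket on $\Gamma E$ such that for all $e,e_1,e_2,e_3\in\Gamma E$, $f\in C^\infty(M)$: (i) $\rho[e_1,e_2]=[\rho e_1,\rho e_2]$; (ii) $\rho\circ\partial=0$; (iii) $\sum_{Cycl}[[e_1,e_2],e_3]=\frac13\partial[\sum_{Cycl}g([e_1,e_2],e_3)]$; (iv) $[e_1,fe_2]=f[e_1,e_2]+((\rho e_1)f)e_2-g(e_1,e_2)\partial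 f$; (v) $(\rho e)(g(e_1,e_2))=g([e,e_1]+\partial g(e,e_1),e_2)+g(e_1,[e,e_2]+\partial g(e,e_2))$. Splitting. Let $\rho$ be surjective and $K=\ker\rho$; then $K^{\perp_g}=\mathrm{im}\,\partial\subseteq K$. A splitting consists of an isotropic subbundle $Q$ complementary to $K$ in $E$ and a subbundle $C$ complementary to $\mathrm{im}\,\partial$ in $K$ such that, with $P=\mathrm{im}\,\partial\oplus Q$, $E=P\oplus C$ is a $g$-orthogonal decomposition (then $g|_C$ is non-degenerate and $g|_P$ is non-degenerate and neutral, i.e. of signature zero); such a $P$ is called a neutral extension of $\mathrm{im}\,\partial$. A Courant algebroid structure with surjective anchor is restricted if $\mathrm{im}\,\partial$ admits a neutral extension $P$ that is bracket-closed, i.e. $[\Gamma P,\Gamma P]\subseteq\Gamma P$. *)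

(* Defs.v *)
From HB Require Import structures.
From mathcomp Require Import all_boot all_order all_algebra.
From mathcomp Require Import all_classical all_reals all_analysis.
Import Order.TTheory GRing.Theory Num.Theory numFieldNormedType.Exports.
Set Implicit Arguments.
Unset Strict Implicit.
Unset Printing Implicit Defensive.
Local Open Scope classical_set_scope.
Local Open Scope ring_scope.

(* The values of [f] outside the open set [U] are irrelevant.  [n_smooth k] is
   what remains of C^infinity at depth k: all partial derivatives of order < k
   are (Frechet) differentiable, those of order k are continuous. *)
Fixpoint n_smooth (R : realType) n (k : nat) (U : set 'rV[R]_n)
    (f : 'rV[R]_n -> R) : Prop :=
  if k is k'.+1 then
    (forall x, U x -> differentiable f x) /\
    (forall i : 'I_n, n_smooth k' U (fun x => 'D_(delta_mx 0 i : 'rV[R]_n) f x))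
  else forall x, U x -> {for x, continuous f}.

Definition Cinfty (R : realType) n (U : set 'rV[R]_n) (f : 'rV[R]_n -> R) :=
  forall k, n_smooth k U f.

(* A chart is a homeomorphism [chart_map] from the open set [chart_dom] onto an
   open subset of R^n, with inverse [chart_inv]; both maps are total functions
   whose values outside these open sets are irrelevant. *)
Record chart (R : realType) (n : nat) (M : topologicalType) := Chart {
  chart_dom : set M;
  chart_map : M -> 'rV[R]_n;
  chart_inv : 'rV[R]_n -> M;
  chart_dom_open : open chart_dom;
  chart_im_open : open (chart_map @` chart_dom);
  chart_mapK : forall x, chart_dom x -> chart_inv (chart_map x) = x;
  chart_map_continuous :
    forall x, chart_dom x -> {for x, continuous chart_map};
  chart_inv_continuous :
    forall y, (chart_map @` chart_dom) y -> {for y, continuous chart_inv} }.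

Record manifold (R : realType) := Manifold {
  msort :> topologicalType;
  mdim : nat;
  chart_idx : Type;
  mchart : chart_idx -> chart R mdim msort;
  manifold_hausdorff : hausdorff_space msort;
  manifold_second_countable : @second_countable msort;
  mchart_cover : forall x, exists c, chart_dom (mchart c) x;
  mchart_transition : forall c d (j : 'I_mdim),
    Cinfty (chart_map (mchart c) @`
              (chart_dom (mchart c) `&` chart_dom (mchart d)))
           (fun y => chart_map (mchart d) (chart_inv (mchart c) y) 0 j) }.

Section Functions.
Context {R : realType}.
Implicit Types M N : manifold R.

(* To be used for open [U] only. *)
Definition smooth_on M (U : set M) (f : M -> R) := forall c : chart_idx M,
  Cinfty (chart_map (mchart c) @` (U `&` chart_dom (mchart c)))
         (f \o chart_inv (mchart c)).

Definition smooth M (f : M -> R) := smooth_on [set: M] f.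

Definition smooth_map N M (i : N -> M) := continuous i /\
  forall (c : chart_idx M) (j : 'I_(mdim M)),
    smooth_on (i @^-1` chart_dom (mchart c))
              (fun y => chart_map (mchart c) (i y) 0 j).

End Functions.

Section Tangent.
Context {R : realType} {M : manifold R}.

(* Tangent vectors at [x] are the derivations at [x] of the algebra of smooth
   functions, extended by 0 to all functions M -> R, so that a tangent vector is
   determined by its values on smooth functions. *)
Definition derivation_at (x : M) (v : (M -> R) -> R) :=
  [/\ forall f, ~ smooth f -> v f = 0,
      forall a f h, smooth f -> smooth h -> v (a *: f + h) = a * v f + v h
    & forall f h, smooth f -> smooth h -> v (f * h) = f x * v h + h x * v f].

Definition derivations (x : M) : {pred (M -> R) -> R} :=
  fun v => `[< derivation_at x v >].

Fact derivations_submod_closed (x : M) : submod_closed (derivations x).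
Proof.
split; first by apply/asboolP; split=> // *; rewrite ?mulr0 addr0.
move=> a u v /asboolP[u0 uL uM] /asboolP[v0 vL vM]; apply/asboolP; split.
- by move=> f nf; rewrite /= !fctE u0// v0// scaler0 addr0.
- move=> b f h sf sh; rewrite /= !fctE uL// vL// /GRing.scale/=.
  by rewrite !mulrDr !mulrA [b * a]mulrC addrACA.
- move=> f h sf sh; rewrite /= !fctE uM// vM// /GRing.scale/=.
  by rewrite !mulrDr !mulrA ![a * _]mulrC addrACA.
Qed.

HB.instance Definition _ (x : M) :=
  GRing.isSubmodClosed.Build R ((M -> R) -> R) (derivations x)
    (derivations_submod_closed x).

Record tangent (x : M) := Tangent {
  tangent_fun :> (M -> R) -> R;
  _ : tangent_fun \in derivations x }.

HB.instance Definition _ (x : M) := [isSub for @tangent_fun x].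
HB.instance Definition _ (x : M) := [Choice of tangent x by <:].
HB.instance Definition _ (x : M) :=
  [SubChoice_isSubLmodule of tangent x by <:].

Definition vector_field (X : forall x : M, tangent x) :=
  forall f, smooth f -> smooth (fun x => X x f).

(* The commutator of two vector fields; [insubd] returns 0 if the commutator is
   not a derivation, which never happens for (smooth) vector fields. *)
Definition lie_bracket (X Y : forall x : M, tangent x) (x : M) : tangent x :=
  insubd (0 : tangent x)
    (fun f => X x (fun y => Y y f) - Y x (fun y => X y f)).

End Tangent.

(* Generalized (Stefan-Sussmann) foliations, possibly singular: through every
   point passes an integral manifold, i.e. a connected immersed submanifold
   whose tangent spaces are given by [D].  The differential of [i] at [y] sends
   [v] to the tangent vector  f |-> v (f \o i). *)
Definition generalized_foliation (R : realType) (M : manifold R)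
    (D : forall x : M, set (tangent x)) :=
  forall x : M, exists (N : manifold R) (i : N -> M),
  [/\ connected [set: N], smooth_map i, injective i, (exists y, i y = x) &
      forall y,
        (forall v : tangent y,
           (forall f, smooth f -> v (f \o i) = 0) -> v = 0) /\
        (forall w : tangent (i y), D (i y) w <->
           exists v : tangent y, forall f, smooth f -> w f = v (f \o i))].

(* A vector bundle is given by its fibers and by local frames, i.e. local
   trivializations, with smooth transition matrices. *)
Record vector_bundle (R : realType) (M : manifold R) := VectorBundle {
  fiber :> M -> vectType R;
  frame_idx : Type;
  frame_dom : frame_idx -> set M;
  frame_rank : frame_idx -> nat;
  frame : forall (i : frame_idx) (x : M), (frame_rank i).-tuple (fiber x);
  frame_dom_open : forall i, open (frame_dom i);
  frame_cover : forall x, exists i, frame_dom i x;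
  frame_basis : forall i x, frame_dom i x -> basis_of fullv (frame i x);
  frame_transition : forall i j (a : 'I_(frame_rank i)) (b : 'I_(frame_rank j)),
    smooth_on (frame_dom i `&` frame_dom j)
              (fun x => coord (frame j x) b (tnth (frame i x) a)) }.

Arguments frame_idx {R M}.
Arguments frame_dom {R M}.
Arguments frame_rank {R M}.
Arguments frame {R M}.

Section Bundles.
Context {R : realType} {M : manifold R} (E : vector_bundle M).

Definition smooth_section_on (U : set M) (s : forall x, E x) :=
  forall i (a : 'I_(frame_rank E i)),
    smooth_on (U `&` frame_dom E i) (fun x => coord (frame E i x) a (s x)).

(* A family of subsets of the fibers; subbundles and images of bundle
   morphisms are such families. *)
Definition subfamily := forall x : M, set (E x).

Definition full : subfamily := fun=> setT.

Definition subbundle (F : subfamily) := forall x : M,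
  exists (U : set M) (k : nat) (t : forall y, k.-tuple (E y)),
  [/\ open U, U x,
      forall a : 'I_k, smooth_section_on U (fun y => tnth (t y) a)
    & forall y, U y -> free (t y) /\ F y = [set` <<t y>>%VS]].

(* The global sections of [F]. *)
Definition section (F : subfamily) (s : forall x, E x) :=
  smooth_section_on setT s /\ forall x, F x (s x).

Definition fsum (F G : subfamily) : subfamily :=
  fun x => [set u + v | u in F x & v in G x].
Arguments fsum : clear implicits.

Definition complementary (F G H : subfamily) := forall x,
  F x `&` G x = [set 0] /\ fsum F G x = H x.

(* Smooth symmetric bilinear forms on the fibers.  Non-degeneracy is required
   separately below, as it depends on the subbundle under consideration. *)
Record metric := Metric {
  metric_form :> forall x, {biscalar E x};
  metric_sym : forall x u v, metric_form x u v = metric_form x v u;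
  metric_smooth : forall i (a b : 'I_(frame_rank E i)),
    smooth_on (frame_dom E i) (fun x =>
      metric_form x (tnth (frame E i x) a) (tnth (frame E i x) b)) }.

(* Smooth bundle morphisms E -> TM. *)
Record anchor := Anchor {
  anchor_map :> forall x, {linear E x -> tangent x};
  anchor_smooth : forall i (a : 'I_(frame_rank E i)) (f : M -> R), smooth f ->
    smooth_on (frame_dom E i) (fun x => anchor_map x (tnth (frame E i x) a) f) }.

Definition surjective_anchor (rho : anchor) :=
  forall x (v : tangent x), exists e, rho x e = v.

Definition anchor_kernel (rho : anchor) : subfamily :=
  fun x => [set e | rho x e = 0].

End Bundles.

Arguments full {R M} E x.
Arguments fsum {R M E} F G x.
Arguments anchor_kernel {R M E} rho x.

Section Courant.
Context {R : realType} {M : manifold R} {E : vector_bundle M}.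
Implicit Types (g : metric E) (rho : anchor E) (F G P Q C : subfamily E).

Definition orthogonal_families g F G :=
  forall x u v, F x u -> G x v -> g x u v = 0.

Definition isotropic g F := orthogonal_families g F F.

(* (F, g|_F) is a pseudo-Euclidean vector bundle. *)
Definition pseudo_euclidean g F := subbundle F /\
  forall x u, F x u -> (forall v, F x v -> g x u v = 0) -> u = 0.

(* g|_F is neutral: every fiber of F is the orthogonal sum of a positive definite
   and of a negative definite subspace of the same dimension. *)
Definition neutral g F := forall x, exists V W : {vspace E x},
  [/\ F x = [set` (V + W)%VS], \dim V = \dim W,
      forall v w, v \in V -> w \in W -> g x v w = 0,
      forall v, v \in V -> v != 0 -> 0 < g x v v
    & forall w, w \in W -> w != 0 -> g x w w < 0].

(* In the following definitions (F, g|_F, rho|_F) is the object under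
   consideration; [F = full E] gives the case of (E, g, rho) itself. *)

(* The vector of F corresponding to the linear form [phi] on F under g|_F. *)
Definition sharp g F x (phi : E x -> R) : E x :=
  xget 0 [set u | F x u /\ forall e, F x e -> g x u e = phi e].

Definition partial g rho F x (alpha : tangent x -> R) : E x :=
  2^-1 *: sharp g F (fun e => alpha (rho x e)).

Definition partial_im g rho F : subfamily E := fun x =>
  [set u | exists alpha : {scalar tangent x}, u = partial g rho F alpha].
Arguments partial_im : clear implicits.

Definition partial_fun g rho F (f : M -> R) (x : M) : E x :=
  partial g rho F (fun v : tangent x => v f).

Definition courant_vector_bundle g rho F :=
  [/\ pseudo_euclidean g F,
      generalized_foliation (fun x => rho x @` F x)
    & isotropic g (partial_im g rho F)].

(* Brackets are total functions on arbitrary families of vectors, but only their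
   values on the global sections of F matter. *)
Record courant_bracket g rho F
    (br : (forall x, E x) -> (forall x, E x) -> forall x, E x) : Prop := {
  br_section : forall e1 e2, section F e1 -> section F e2 ->
    section F (br e1 e2);
  br_linear : forall a e1 e2 e, section F e1 -> section F e2 -> section F e ->
    forall x, br (fun y => a *: e1 y + e2 y) e x = a *: br e1 e x + br e2 e x;
  br_skew : forall e1 e2, section F e1 -> section F e2 ->
    forall x, br e1 e2 x = - br e2 e1 x;
  br_anchor : forall e1 e2, section F e1 -> section F e2 ->
    forall x, rho x (br e1 e2 x) =
      lie_bracket (fun y => rho y (e1 y)) (fun y => rho y (e2 y)) x;
  br_anchor_partial : forall x (alpha : {scalar tangent x}),
    rho x (partial g rho F alpha) = 0;
  br_jacobi : forall e1 e2 e3, section F e1 -> section F e2 -> section F e3 ->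
    forall x, br (br e1 e2) e3 x + br (br e2 e3) e1 x + br (br e3 e1) e2 x =
      3^-1 *: partial_fun g rho F (fun y =>
        g y (br e1 e2 y) (e3 y) + g y (br e2 e3 y) (e1 y)
        + g y (br e3 e1 y) (e2 y)) x;
  br_leibniz : forall e1 e2 (f : M -> R),
    section F e1 -> section F e2 -> smooth f ->
    forall x, br e1 (fun y => f y *: e2 y) x =
      f x *: br e1 e2 x + rho x (e1 x) f *: e2 x
      - g x (e1 x) (e2 x) *: partial_fun g rho F f x;
  br_metric : forall e e1 e2, section F e -> section F e1 -> section F e2 ->
    forall x, rho x (e x) (fun y => g y (e1 y) (e2 y)) =
      g x (br e e1 x + partial_fun g rho F (fun y => g y (e y) (e1 y)) x) (e2 x)
      + g x (e1 x)
          (br e e2 x + partial_fun g rho F (fun y => g y (e y) (e2 y)) x) }.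

(* (F, g|_F, rho|_F) carries a Courant algebroid structure. *)
Definition courant_algebroid g rho F := courant_vector_bundle g rho F /\
  exists br, courant_bracket g rho F br.

(* The total space P of the splitting given by Q. *)
Definition extension g rho Q : subfamily E :=
  fsum (partial_im g rho (full E)) Q.
Arguments extension : clear implicits.

Record splitting g rho Q C : Prop := {
  split_Q : subbundle Q;
  split_Q_isotropic : isotropic g Q;
  split_Q_complement : complementary Q (anchor_kernel rho) (full E);
  split_C : subbundle C;
  split_C_complement :
    complementary C (partial_im g rho (full E)) (anchor_kernel rho);
  split_sum : complementary (extension g rho Q) C (full E);
  split_orthogonal : orthogonal_families g (extension g rho Q) C }.

(* (E, g, rho) has a restricted Courant algebroid structure. *)
Definition has_restricted_courant_structure g rho := exists br,
  courant_bracket g rho (full E) br /\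
  exists Q C, splitting g rho Q C /\
    forall e1 e2, section (extension g rho Q) e1 ->
      section (extension g rho Q) e2 -> section (extension g rho Q) (br e1 e2).

(* Linear connections on the subbundle C, compatible with g and with zero
   curvature.  As for brackets, only the values on vector fields and on global
   sections of C matter. *)
Record flat_metric_connection g C
    (nabla : (forall x : M, tangent x) -> (forall x, E x) -> forall x, E x)
    : Prop := {
  nabla_section : forall X s, vector_field X -> section C s ->
    section C (nabla X s);
  nabla_linear_l : forall (f : M -> R) X Y s, smooth f ->
    vector_field X -> vector_field Y -> section C s ->
    forall x, nabla (fun y => f y *: X y + Y y) s x =
      f x *: nabla X s x + nabla Y s x;
  nabla_linear_r : forall (a : R) X s t,
    vector_field X -> section C s -> section C t ->
    forall x, nabla X (fun y => a *: s y + t y) x =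
      a *: nabla X s x + nabla X t x;
  nabla_leibniz : forall (f : M -> R) X s, smooth f ->
    vector_field X -> section C s ->
    forall x, nabla X (fun y => f y *: s y) x =
      X x f *: s x + f x *: nabla X s x;
  nabla_metric : forall X s t, vector_field X -> section C s -> section C t ->
    forall x, X x (fun y => g y (s y) (t y)) =
      g x (nabla X s x) (t x) + g x (s x) (nabla X t x);
  nabla_flat : forall X Y s, vector_field X -> vector_field Y -> section C s ->
    forall x, nabla X (nabla Y s) x - nabla Y (nabla X s) x
      - nabla (lie_bracket X Y) s x = 0 }.

Definition flat_pseudo_euclidean g C := pseudo_euclidean g C /\
  exists nabla, flat_metric_connection g C nabla.

End Courant.

Arguments partial_im {R M E} g rho F x.
Arguments extension {R M E} g rho Q x.

(* Main.v *)
Require Import Defs.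
From HB Require Import structures.
From mathcomp Require Import all_boot all_order all_algebra.
From mathcomp Require Import all_classical all_reals all_analysis.
From mathcomp Require Import ring lra.
Import Order.TTheory GRing.Theory Num.Theory numFieldNormedType.Exports.
Set Implicit Arguments.
Unset Strict Implicit.
Unset Printing Implicit Defensive.
Local Open Scope classical_set_scope.
Local Open Scope ring_scope.

(** In a splitting [E = P + C] the part [C] lies in the kernel of the anchor and
    [P] contains a lift [Q] of the tangent bundle, so [P] acts on sections of [C].
    A bracket for which [P] is closed amounts to a bracket on [P] together with a
    flat metric connection on [C], but for the freedom of choosing the
    [C]-component of the bracket of two sections of [C].

    From left to right, let [p] be a section of [P] and [s] one of [C].  The metric
    axiom shows that [[p, s]] is orthogonal to [P], hence a section of [C]
    ([bracket_PC_in_C]).  By the Leibniz rule it is linear over functions in [p],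
    since the anchor of [s] and the product of [p] and [s] vanish, and it is 0 when
    [p] takes values in the image of the coboundary ([bracket_imC_eq0]).  So [p]
    enters through its anchor only, and [nabla_X s = [lift X, s]] is a metric
    connection, whose flatness is the Jacobi identity ([bracket_connection]).
    Neutrality of [P] is linear algebra: [P] is the sum of two isotropic subspaces
    in duality ([neutral_of_isotropic]).

    From right to left, put, for [e_i = p_i + s_i],
      [[e_1, e_2] = [p_1, p_2] + nabla_1 s_2 - nabla_2 s_1 + beta(s_1, s_2)],
    where [nabla_i] is the derivative along the anchor of [e_i] and [beta(s, t)] is
    the coboundary of the 1-form [g(nabla s, t) - g(s, nabla t)]; the metric axiom
    leaves no other choice for the [P]-component.  The axioms are then computed;
    for the Jacobi identity ([sum_bracket_jacobi]) both sides are tested against a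
    fourth section, and it reduces to the Jacobi identity of [P] and to flatness.

    All of this needs many global sections, and smoothness of the objects that are
    constructed fiber by fiber.  Every vector of a subbundle extends to a global
    section ([extend_to_section]), by means of bump functions ([bump_function])
    built from [exp(-1/t)] in charts.  Smoothness of lifts, projections and [beta]
    is read off from their values under a family of smooth covectors that separates
    the fibers ([smooth_of_covectors]).  A connection, given on global vector fields
    only, can be evaluated on single tangent vectors ([nabla_pointwise]). *)

(** * Smooth functions of several real variables *)

Section SmoothCoordinates.
Context {R : realType} {n : nat}.
Implicit Types (U V : set 'rV[R]_n) (f g : 'rV[R]_n -> R).

Lemma near_eq_differentiable f g x :
  (\near x, f x = g x) -> differentiable f x -> differentiable g x.
Proof.
move=> fg df; pose h := g - f.
have h0 : \forall z \near x, h z = 0.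
  by apply: filterS fg => z fgz; rewrite /h !fctE fgz subrr.
have hx : h x = 0 by exact: nbhs_singleton h0.
have E : h \o shift x = cst (h x) + (\0 : {linear 'rV[R]_n -> R}) +o_ 0 id.
  apply/eqaddoP => e e0.
  have : \forall z \near (0 : 'rV[R]_n), h (z + x) = 0.
    have := h0; rewrite (near_shift 0 x) => H.
    by apply: filterS H => z /=; have -> : x - 0 = x by exact: subr0.
  apply: filterS => z hz; rewrite !fctE /= hz hx addr0 subr0 normr0.
  by rewrite mulr_ge0// ltW.
have hc : continuous (\0 : {linear 'rV[R]_n -> R}) by exact: cst_continuous.
have dh : differentiable h x.
  by apply/diff_locallyP; rewrite (diff_unique hc E); split.
have -> : g = f + h by rewrite /h addrC subrK.
exact: differentiableD.
Qed.

(** Openness of [U] matters: the higher derivatives at a point of [U] only see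
    the values of the function on [U] because a neighborhood lies in [U].  All
    the differentiation rules below rest on this, as the rule for a first
    derivative holds on [U] only. *)
Lemma n_smooth_eq k U f g : open U -> (forall x, U x -> f x = g x) ->
  n_smooth k U f -> n_smooth k U g.
Proof.
move=> oU; have nU x : U x -> nbhs x U by move=> ?; exact: open_nbhs_nbhs.
elim: k f g => [|k IH] f g fg /=.
  move=> cf x Ux; have := cf x Ux; rewrite /prop_for /continuous_at -fg//.
  have H : \forall y \near x, f y = g y.
    by apply: filterS (nU x Ux) => y Uy; rewrite fg.
  exact: (cvg_trans (near_eq_cvg H)).
move=> [df Df]; split=> [x Ux|i].
  apply: near_eq_differentiable (df x Ux).
  by apply: filterS (nU x Ux) => y Uy; rewrite fg.
apply: IH (Df i) => x Ux; apply: near_eq_derive.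
by apply: filterS (nU x Ux) => y Uy; rewrite fg.
Qed.

Lemma n_smooth_sub k U V f : V `<=` U -> n_smooth k U f -> n_smooth k V f.
Proof.
move=> VU; elim: k f => [|k IH] f /=; first by move=> cf x /VU; exact: cf.
by move=> [df Df]; split=> [x /VU/df//|i]; exact: IH.
Qed.

Lemma n_smooth_bigcup k (I : Type) (U : I -> set 'rV[R]_n) f :
  (forall i, n_smooth k (U i) f) -> n_smooth k (\bigcup_i U i) f.
Proof.
elim: k f => [|k IH] f /=; first by move=> H x [i _ Ux]; exact: H Ux.
move=> H; split=> [x [i _ Ux]|j]; first by have [+ _] := H i; apply.
by apply: IH => i; case: (H i).
Qed.

Lemma n_smoothW k U f : n_smooth k.+1 U f -> n_smooth k U f.
Proof.
elim: k f => [|k IH] f; first by case=> df _ x /df /differentiable_continuous.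
by case=> df Df; split=> // i; exact: IH.
Qed.

Lemma n_smooth_cst k U a : n_smooth k U (fun=> a).
Proof.
elim: k a => [|k IH] a /=; first by move=> x _; exact: cst_continuous.
split=> [x _|i]; first exact: differentiable_cst.
have -> : 'D_(delta_mx 0 i : 'rV[R]_n) (fun=> a) = fun=> 0; last exact: IH.
by apply/funext => x; exact: derive_cst.
Qed.

Lemma n_smoothD k U f g : open U -> n_smooth k U f -> n_smooth k U g ->
  n_smooth k U (f + g).
Proof.
move=> oU; elim: k f g => [|k IH] f g /=.
  by move=> cf cg x Ux; exact: continuousD (cf x Ux) (cg x Ux).
move=> [df Df] [dg Dg]; split=> [x Ux|i].
  by apply: differentiableD; [exact: df|exact: dg].
apply: (n_smooth_eq oU) (IH _ _ (Df i) (Dg i)) => x Ux.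
by rewrite deriveD//; apply: diff_derivable; [exact: df|exact: dg].
Qed.

Lemma n_smoothM k U f g : open U -> n_smooth k U f -> n_smooth k U g ->
  n_smooth k U (f * g).
Proof.
move=> oU; elim: k f g => [|k IH] f g.
  by move=> cf cg x Ux; exact: continuousM (cf x Ux) (cg x Ux).
move=> sf sg; have [[df Df] [dg Dg]] := (sf, sg); split=> [x Ux|i].
  by apply: differentiableM; [exact: df|exact: dg].
have := n_smoothD oU (IH _ _ (n_smoothW sf) (Dg i))
  (IH _ _ (n_smoothW sg) (Df i)).
apply: n_smooth_eq => // x Ux; rewrite !fctE deriveM//.
- by apply: diff_derivable; exact: df.
- by apply: diff_derivable; exact: dg.
Qed.

Lemma n_smoothV k U f : open U -> (forall x, U x -> f x != 0) ->
  n_smooth k U f -> n_smooth k U (fun x => (f x)^-1).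
Proof.
move=> oU f0; elim: k => [|k IH].
  by move=> cf x Ux; exact: continuousV (f0 x Ux) (cf x Ux).
move=> sf; have [df Df] := sf; split=> [x Ux|i].
  by apply: differentiableV; [exact: df|exact: f0].
have sV := IH (n_smoothW sf).
have := n_smoothM oU (n_smooth_cst k U (-1))
  (n_smoothM oU (n_smoothM oU sV sV) (Df i)).
apply: n_smooth_eq => // x Ux.
rewrite !fctE deriveV//; [|exact: f0|by apply: diff_derivable; exact: df].
by rewrite mulN1r scaleNr -exprVn expr2.
Qed.

(** By induction on the order, simultaneously for a class [S] of one-variable
    functions that is stable under derivation. *)
Lemma n_smooth_comp k (S : set (R -> R)) U f : open U ->
  (forall h, S h -> (forall t, derivable h t 1) /\ S (fun t => 'D_1 h t)) ->
  n_smooth k U f -> forall h, S h -> n_smooth k U (h \o f).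
Proof.
move=> oU HS; elim: k => [|k IH] sf h Sh.
  move=> x Ux; apply: continuous_comp; first exact: sf.
  apply: differentiable_continuous; apply/derivable1_diffP.
  by have [] := HS _ Sh.
have [dh SDh] := HS _ Sh; have [df Df] := sf.
have dh' t : differentiable h t by exact/derivable1_diffP.
split=> [x Ux|i]; first by apply: differentiable_comp => //; exact: df.
have := n_smoothM oU (IH (n_smoothW sf) _ SDh) (Df i).
apply: n_smooth_eq => // x Ux; have dfx := df x Ux.
rewrite !fctE /= !deriveE//; last exact: differentiable_comp.
rewrite (diff_comp dfx (dh' (f x))) /=; set t := 'd f x _.
by rewrite -[t in RHS]mulr1 -[t * 1 in RHS]/(t *: 1) linearZ mulrC.
Qed.

End SmoothCoordinates.

(** * A smooth bump function on the line *)

Section FlatExponential.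
Context {R : realType}.
Implicit Types (t : R) (p : {poly R}).

(** The polynomial factor makes the class of these functions stable under
    derivation. *)
Definition flat_exp p t := if 0 < t then p.[t^-1] * expR (- t^-1) else 0.

(** From the single term [s^(k+2)/(k+2)!] of the exponential series. *)
Lemma mono_exp_bound k (s : R) : 0 <= s -> s ^+ k.+2 * expR (- s) <= k.+2`!%:R.
Proof.
move=> s0; rewrite expRN ler_pdivrMr ?expR_gt0//.
have := expR_ge1Dxn k.+1 s0; rewrite -ler_pdivrMl ?ltr0n ?fact_gt0//.
move=> H; apply: le_trans H; rewrite mulrC lerDr//.
Qed.

(** The exponent 2 makes the difference quotients at 0 tend to 0. *)
Lemma flat_exp_bound p :
  exists2 C : R, 0 <= C & forall t, `|flat_exp p t| <= C * t ^+ 2.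
Proof.
pose C := \sum_(i < size p) `|p`_i| * i.+2`!%:R : R.
have C0 : 0 <= C by apply: sumr_ge0 => i _; rewrite mulr_ge0.
exists C => // t; rewrite /flat_exp; case: ifP => [t0|_]; last first.
  by rewrite normr0 mulr_ge0// sqr_ge0.
have s0 : 0 <= t^-1 by rewrite invr_ge0 ltW.
rewrite -ler_pdivrMr ?exprn_gt0// -exprVn horner_coef mulr_suml.
rewrite -[X in _ * X]ger0_norm ?exprn_ge0// -normrM mulr_suml.
apply: le_trans (ler_norm_sum _ _ _) _; apply: ler_sum => i _.
rewrite -!mulrA normrM ler_wpM2l// [X in _ * X]mulrC mulrA -exprD addn2.
rewrite ger0_norm; first exact: mono_exp_bound.
by apply: mulr_ge0; [exact: exprn_ge0|exact: expR_ge0].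
Qed.

Lemma flat_exp_derive p t :
  is_derive t 1 (flat_exp p) (flat_exp ('X^2 * (p - p^`())) t).
Proof.
have [t0|t0|->] := ltgtP t 0.
- have E : \near t, 0 = flat_exp p t.
    by have := lt_nbhsl t0; apply: filterS => z z0; rewrite /flat_exp ltNge ltW.
  apply: (near_eq_is_derive E); rewrite /flat_exp ltNge ltW//=.
  exact: is_derive_cst.
- have E : \near t, p.[t^-1] * expR (- t^-1) = flat_exp p t.
    by have := lt_nbhsr t0; apply: filterS => z z0; rewrite /flat_exp z0.
  apply: (near_eq_is_derive E); rewrite /flat_exp t0.
  have t0' : t != 0 by rewrite gt_eqF.
  have dV : is_derive t 1 (fun t => t^-1) (- t ^- 2).
    have := @is_deriveV _ id t 1 1 t0' _; rewrite /GRing.scale /= mulr1; exact.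
  have dN : is_derive t 1 (fun t => - t^-1) (t ^- 2).
    by rewrite -[t ^- 2]opprK; apply: is_deriveN.
  have dE := is_derive1_comp (is_derive_expR _) dN.
  have dP := is_derive1_comp (is_derive_poly p _) dV.
  have H := is_deriveM dP dE; apply: (is_derive_eq H).
  have -> : ('X^2 * (p - p^`())).[t^-1] = t ^- 2 * (p.[t^-1] - p^`().[t^-1]).
    by rewrite hornerM hornerXn hornerD hornerN exprVn.
  by rewrite /GRing.scale /=; ring.
- rewrite {2}/flat_exp ltxx.
  have [C C0 HC] := flat_exp_bound p.
  have H : h^-1 *: (flat_exp p (h *: 1 + 0) - flat_exp p 0) @[h --> 0^'] --> 0.
    apply/cvgr0Pnorm_le => e e0; have C1 : 0 < C + 1 by rewrite ltr_wpDl.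
    near=> h.
    have h0 : h != 0 by near: h; exact: nbhs_dnbhs_neq.
    rewrite addr0 {2}/flat_exp ltxx subr0 /GRing.scale /= mulr1 normrM normfV.
    rewrite mulrC ler_pdivrMr ?normr_gt0//; apply: le_trans (HC h) _.
    rewrite -real_normK ?num_real// expr2 mulrA ler_wpM2r//.
    apply: (@le_trans _ _ ((C + 1) * `|h|)); first by rewrite ler_wpM2r// lerDl.
    rewrite mulrC -ler_pdivlMr//; near: h; apply: dnbhs0_le.
    exact: divr_gt0.
  apply: DeriveDef; first by apply/cvg_ex; exists 0.
  exact: cvg_lim H.
Unshelve. all: by end_near. Qed.

Lemma flat_exp_gt0 t : 0 < t -> 0 < flat_exp 1 t.
Proof. by move=> t0; rewrite /flat_exp t0 hornerC mul1r expR_gt0. Qed.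

Lemma flat_exp_le0 p t : t <= 0 -> flat_exp p t = 0.
Proof. by move=> t0; rewrite /flat_exp ltNge t0. Qed.

Lemma Cinfty_flat_exp {n : nat} p (U : set 'rV[R]_n) f : open U ->
  Cinfty U f -> Cinfty U (flat_exp p \o f).
Proof.
move=> oU sf k; apply: (@n_smooth_comp _ _ _ (range flat_exp)) => //.
move=> _ [q _ <-]; split; first by move=> t; have [] := flat_exp_derive q t.
exists ('X^2 * (q - q^`())) => //; apply/funext => t.
by have [_ ->] := flat_exp_derive q t.
Qed.

End FlatExponential.

(** * Smooth functions on manifolds *)

Section ManifoldFunctions.
Context {R : realType} {M : manifold R}.
Implicit Types (U V : set M) (f g : M -> R) (x : M).

Lemma chart_image_open (c : chart_idx M) U :
  open U -> open (chart_map (mchart c) @` (U `&` chart_dom (mchart c))).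
Proof.
move=> oU; set d := mchart c; rewrite openE => y [x [Ux dx] <-].
have imx : (chart_map d @` chart_dom d) (chart_map d x) by exists x.
have N1 : nbhs (chart_map d x) (chart_map d @` chart_dom d).
  by apply: open_nbhs_nbhs; split=> //; exact: chart_im_open.
have N2 : nbhs (chart_map d x) (chart_inv d @^-1` (U `&` chart_dom d)).
  apply: (chart_inv_continuous imx); rewrite chart_mapK//.
  by apply: open_nbhs_nbhs; split=> //; apply: openI => //; exact: chart_dom_open.
apply: filterS (filterI N1 N2) => _ [[z dz <-] /=].
by rewrite chart_mapK// => Uz; exists z.
Qed.

Lemma smooth_on_sub U V f : V `<=` U -> smooth_on U f -> smooth_on V f.
Proof.
move=> VU sf c k; apply: n_smooth_sub (sf c k).
by move=> _ [x [Vx dx] <-]; exists x => //; split=> //; exact: VU.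
Qed.

Lemma smooth_on_eq U f g : open U -> (forall x, U x -> f x = g x) ->
  smooth_on U f -> smooth_on U g.
Proof.
move=> oU fg sf c k; apply: n_smooth_eq (sf c k); first exact: chart_image_open.
by move=> _ [x [Ux dx] <-] /=; rewrite chart_mapK// fg.
Qed.

Lemma smooth_on_bigcup (I : Type) (U : I -> set M) f :
  (forall i, smooth_on (U i) f) -> smooth_on (\bigcup_i U i) f.
Proof.
move=> sf c k.
have := n_smooth_bigcup (fun i => sf i c k); apply: n_smooth_sub.
by move=> _ [x [[i _ Ux] dx] <-]; exists i => //; exists x.
Qed.

(** A neighborhood is needed: on a singleton [smooth_on] would constrain the
    higher derivatives without relating them to those of a sum or product. *)
Definition smooth_at x f := exists U, [/\ open U, U x & smooth_on U f].

Lemma smooth_onP U f : open U ->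
  smooth_on U f <-> forall x, U x -> smooth_at x f.
Proof.
move=> oU; split=> [sf x Ux|sf]; first by exists U.
have /choice[V HV] : forall x : {x | U x}, exists V,
    [/\ open V, V (sval x) & smooth_on V f].
  by case=> x Ux; exact: sf.
apply: (@smooth_on_sub (\bigcup_i V i)) => [x Ux|].
  by exists (exist _ x Ux) => //; case: (HV (exist _ x Ux)).
by apply: smooth_on_bigcup => i; case: (HV i).
Qed.

Lemma smoothP f : smooth f <-> forall x, smooth_at x f.
Proof.
rewrite /smooth smooth_onP; last exact: openT.
by split=> sf x; [apply: sf|move=> _; apply: sf].
Qed.

Lemma smooth_at_eq x f g : (\near x, f x = g x) ->
  smooth_at x f -> smooth_at x g.
Proof.
move=> nfg [U [oU Ux sf]].
have : nbhs x [set y | f y = g y] := nfg; rewrite nbhsE => -[V [oV Vx] fg].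
exists (U `&` V); split; [exact: openI|by []|].
have := smooth_on_sub (@subIsetl _ U V) sf.
by apply: smooth_on_eq => [|y [_ /fg]//]; exact: openI.
Qed.

Lemma smooth_at_cst x a : smooth_at x (fun=> a).
Proof. by exists setT; split=> // [|c k]; [exact: openT|exact: n_smooth_cst]. Qed.

Lemma smooth_at_op2 (op : (M -> R) -> (M -> R) -> M -> R) :
  (forall U f g, open U -> smooth_on U f -> smooth_on U g ->
    smooth_on U (op f g)) ->
  forall x f g, smooth_at x f -> smooth_at x g -> smooth_at x (op f g).
Proof.
move=> Hop x f g [U [oU Ux sf]] [V [oV Vx sg]].
exists (U `&` V); split=> //; first exact: openI.
apply: Hop; first exact: openI.
  by apply: smooth_on_sub sf; exact: subIsetl.
by apply: smooth_on_sub sg; exact: subIsetr.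
Qed.

Lemma smooth_atD x f g : smooth_at x f -> smooth_at x g ->
  smooth_at x (fun y => f y + g y).
Proof.
apply: (smooth_at_op2 (op := fun f g y => f y + g y)) => U {}f {}g oU sf sg c k.
by apply: n_smoothD (sf c k) (sg c k); exact: chart_image_open.
Qed.

Lemma smooth_atM x f g : smooth_at x f -> smooth_at x g ->
  smooth_at x (fun y => f y * g y).
Proof.
apply: (smooth_at_op2 (op := fun f g y => f y * g y)) => U {}f {}g oU sf sg c k.
by apply: n_smoothM (sf c k) (sg c k); exact: chart_image_open.
Qed.

Lemma smooth_atN x f : smooth_at x f -> smooth_at x (fun y => - f y).
Proof.
move=> sf; rewrite (_ : (fun y => _) = fun y => -1 * f y).
  exact: smooth_atM (smooth_at_cst x (-1)) sf.
by apply/funext => y; rewrite mulN1r.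
Qed.

Lemma smooth_atB x f g : smooth_at x f -> smooth_at x g ->
  smooth_at x (fun y => f y - g y).
Proof. by move=> sf /smooth_atN; exact: smooth_atD. Qed.

Lemma smooth_at_sum x (I : Type) (r : seq I) (P : pred I) (F : I -> M -> R) :
  (forall i, P i -> smooth_at x (F i)) ->
  smooth_at x (fun y => \sum_(i <- r | P i) F i y).
Proof.
move=> sF; elim: r => [|i r IH].
  by under eq_fun do rewrite big_nil; exact: smooth_at_cst.
under eq_fun do rewrite big_cons.
by case: (P i) (sF i) => // sFi; exact: (smooth_atD (sFi isT) IH).
Qed.

Lemma smooth_at_prod x (I : Type) (r : seq I) (P : pred I) (F : I -> M -> R) :
  (forall i, P i -> smooth_at x (F i)) ->
  smooth_at x (fun y => \prod_(i <- r | P i) F i y).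
Proof.
move=> sF; elim: r => [|i r IH].
  by under eq_fun do rewrite big_nil; exact: smooth_at_cst.
under eq_fun do rewrite big_cons.
by case: (P i) (sF i) => // sFi; exact: (smooth_atM (sFi isT) IH).
Qed.

Lemma smooth_at_det x n (A : M -> 'M[R]_n) :
  (forall i j, smooth_at x (fun y => A y i j)) ->
  smooth_at x (fun y => \det (A y)).
Proof.
move=> sA; apply: smooth_at_sum => s _; apply: smooth_atM.
  exact: smooth_at_cst.
by apply: smooth_at_prod => i _; exact: sA.
Qed.

Lemma smooth_at_adj x n (A : M -> 'M[R]_n) :
  (forall i j, smooth_at x (fun y => A y i j)) ->
  forall i j, smooth_at x (fun y => (\adj (A y)) i j).
Proof.
move=> sA i j.
have -> : (fun y => (\adj (A y)) i j) =
    (fun y => (-1) ^+ (j + i) * \det (row' j (col' i (A y)))).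
  by apply/funext => y; rewrite mxE.
apply: smooth_atM; first exact: smooth_at_cst.
apply: smooth_at_det => a b.
have -> : (fun y => row' j (col' i (A y)) a b) =
    (fun y => A y (lift j a) (lift i b)).
  by apply/funext => y; rewrite !mxE.
exact: sA.
Qed.

Lemma smoothD f g : smooth f -> smooth g -> smooth (fun y => f y + g y).
Proof.
move=> /smoothP sf /smoothP sg; apply/smoothP => x.
exact: (smooth_atD (sf x) (sg x)).
Qed.

Lemma smoothB f g : smooth f -> smooth g -> smooth (fun y => f y - g y).
Proof.
move=> /smoothP sf /smoothP sg; apply/smoothP => x.
exact: (smooth_atB (sf x) (sg x)).
Qed.

Lemma smoothM f g : smooth f -> smooth g -> smooth (fun y => f y * g y).
Proof.
move=> /smoothP sf /smoothP sg; apply/smoothP => x.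
exact: (smooth_atM (sf x) (sg x)).
Qed.

Lemma smooth_cst a : smooth (fun _ : M => a).
Proof. by apply/smoothP => x; exact: smooth_at_cst. Qed.

Lemma smooth_at_continuous x f : smooth_at x f -> {for x, continuous f}.
Proof.
move=> [U [oU Ux sf]]; have [c dx] := mchart_cover x; set d := mchart c.
have Cf : {for chart_map d x, continuous (f \o chart_inv d)}.
  by apply: (sf c 0); exists x.
have nd : nbhs x (chart_dom d).
  by apply: open_nbhs_nbhs; split=> //; exact: chart_dom_open.
have E : {near x, (f \o chart_inv d) \o chart_map d =1 f}.
  by apply: filterS nd => y dy /=; rewrite chart_mapK.
have CC : {for x, continuous ((f \o chart_inv d) \o chart_map d)}.
  by apply: continuous_comp => //; exact: chart_map_continuous.
have := CC; rewrite /prop_for /continuous_at /= chart_mapK//.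
by apply: cvg_trans; exact: near_eq_cvg.
Qed.

Lemma smooth_at_neq0 x f : smooth_at x f -> f x != 0 -> \near x, f x != 0.
Proof.
move=> /smooth_at_continuous cf fx.
have : nbhs (f x) [set t | t != 0] by exact: open_nbhs_nbhs.
exact: cf.
Qed.

Lemma smooth_atV x f : smooth_at x f -> f x != 0 ->
  smooth_at x (fun y => (f y)^-1).
Proof.
move=> sf fx; have : nbhs x [set y | f y != 0] := smooth_at_neq0 sf fx.
rewrite nbhsE => -[V [oV Vx] f0]; have [U [oU Ux {}sf]] := sf.
have oUV : open (U `&` V) by exact: openI.
exists (U `&` V); split=> // c k.
apply: (@n_smoothV _ _ _ _ (f \o chart_inv (mchart c))).
- exact: chart_image_open.
- by move=> _ [z [[_ Vz] dz] <-] /=; rewrite chart_mapK//; exact: f0.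
- by apply: (smooth_on_sub _ sf); exact: subIsetl.
Qed.

Lemma smooth_at_coord x c j : chart_dom (mchart c) x ->
  smooth_at x (fun y => chart_map (mchart c) y 0 j).
Proof.
move=> dx; exists (chart_dom (mchart c)); split=> // [|d].
  exact: chart_dom_open.
by rewrite setIC; exact: mchart_transition.
Qed.

Lemma smooth_at_flat_exp x p f : smooth_at x f ->
  smooth_at x (fun y => flat_exp p (f y)).
Proof.
move=> [U [oU Ux sf]]; exists U; split=> // c.
by apply: Cinfty_flat_exp => //; exact: chart_image_open.
Qed.

(** A product of one-variable bumps in the coordinates of a chart, whose support
    is a compact cube.  The Hausdorff axiom makes the image of the cube closed in
    the manifold, so that the product stays smooth when it is extended by 0. *)
Lemma bump_function U x : open U -> U x ->
  exists (phi : M -> R) (K : set M), [/\ smooth phi, phi x = 1, closed K,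
    K `<=` U & forall y, ~ K y -> phi y = 0].
Proof.
move=> oU Ux; have [c dx] := mchart_cover x.
pose d := mchart c; pose a := chart_map d x.
pose W := chart_map d @` (U `&` chart_dom d).
have nW : nbhs a W.
  apply: open_nbhs_nbhs; split; first exact: chart_image_open.
  by exists x.
have [e /= e0 HW] : nbhs_ball a W by rewrite nbhs_ballE.
pose r := e / 2; have r0 : 0 < r by rewrite divr_gt0.
pose B := [set y : 'rV[R]_(mdim M) |
  forall j, `[a 0 j - r, a 0 j + r]%classic (y 0 j)].
have cB : compact B.
  apply: (@rV_compact _ _ (fun j => `[a 0 j - r, a 0 j + r]%classic)) => j.
   exact: segment_compact.
have BE y : B y <-> forall j, (y 0 j - a 0 j) ^+ 2 <= r ^+ 2.
  have E t s : `[s - r, s + r]%classic t <-> (t - s) ^+ 2 <= r ^+ 2.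
    rewrite /= in_itv/= -ler_distl -(real_normK (num_real (t - s))).
    by rewrite ler_pXn2r// ?nnegrE; exact: ltW.
  by split=> H j; apply/E.
have BW : B `<=` W.
  move=> y /BE By; apply: HW; split=> // i j; rewrite ord1 /ball /= distrC.
  have : `|y 0 j - a 0 j| <= r.
    have := By j; rewrite -(real_normK (num_real (y 0 j - a 0 j))).
    by rewrite ler_pXn2r// ?nnegrE; exact: ltW.
  by move=> /le_lt_trans; apply; rewrite /r ltr_pdivrMr// mulr_natr mulr2n ltrDl.
pose K := chart_inv d @` B.
have KUd : K `<=` U `&` chart_dom d.
  by move=> _ [y /BW[z [Uz dz] <-] <-]; rewrite chart_mapK.
have cK : closed K.
  apply: compact_closed; first exact: manifold_hausdorff.
  apply: continuous_compact cB; apply: continuous_in_subspaceT => y.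
  rewrite inE => /BW[z [_ dz] <-]; apply: chart_inv_continuous.
  by exists z.
pose psi z := \prod_j flat_exp 1 (r ^+ 2 - (chart_map d z 0 j - a 0 j) ^+ 2).
have psi0 z : chart_dom d z -> ~ K z -> psi z = 0.
  move=> dz nKz; have : ~ B (chart_map d z).
    by move=> Bz; apply: nKz; exists (chart_map d z) => //; rewrite chart_mapK.
  move=> /BE /existsNP[j /negP]; rewrite -ltNge => Hj.
  by rewrite /psi (bigD1 j)//= flat_exp_le0 ?mul0r// subr_le0 ltW.
have psix : 0 < psi x.
  apply: prodr_gt0 => j _; rewrite subrr expr0n subr0.
  by apply: flat_exp_gt0; rewrite exprn_gt0.
pose phi z := if `[< chart_dom d z >] then psi z / psi x else 0.
exists phi, K; split=> //.
- apply/smoothP => z; have [dz|dz] := pselect (chart_dom d z).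
    have E : \forall y \near z, psi y / psi x = phi y.
      have : nbhs z (chart_dom d).
        by apply: open_nbhs_nbhs; split=> //; exact: chart_dom_open.
      by apply: filterS => y dy; rewrite /phi asboolT.
    apply: (smooth_at_eq E); apply: smooth_atM; last exact: smooth_at_cst.
    apply: smooth_at_prod => j _; apply: smooth_at_flat_exp.
    apply: smooth_atB; first exact: smooth_at_cst.
    have sj : smooth_at z (fun y => chart_map d y 0 j - a 0 j).
      by apply: smooth_atB; [exact: smooth_at_coord|exact: smooth_at_cst].
    exact: (smooth_atM sj sj).
  have E : \forall y \near z, 0 = phi y.
    have : nbhs z (~` K).
      apply: open_nbhs_nbhs; split; first exact: closed_openC.
      by move=> /KUd[].
    apply: filterS => y nKy; rewrite /phi; case: asboolP => // dy.
    by rewrite psi0// mul0r.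
  by apply: (smooth_at_eq E); exact: smooth_at_cst.
- by rewrite /phi asboolT// divff// gt_eqF.
- by move=> z /KUd[].
- by move=> z nKz; rewrite /phi; case: asboolP => // dz; rewrite psi0// mul0r.
Qed.

End ManifoldFunctions.

(** * Smooth sections of vector bundles *)

Lemma self_double_eq0 (V : zmodType) (u : V) : u = u + u -> u = 0.
Proof. by move=> uu; apply: (addrI u); rewrite -uu addr0. Qed.

(** Rows are chosen one at a time: while the rank is not full, the rows chosen so
    far have a common kernel, on which some member of the family is nonzero. *)
Lemma select_invertible (K : fieldType) k (T : Type) (A : T -> 'rV[K]_k) :
  (forall w : 'cV[K]_k, (forall t, A t *m w = 0) -> w = 0) ->
  exists f : 'I_k -> T, \matrix_(i, j) A (f i) 0 j \in unitmx.
Proof.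
move=> sep.
suff H r : (r <= k)%N ->
    exists f : 'I_r -> T, \rank (\matrix_(i, j) A (f i) 0 j) = r.
  have [f Hf] := H k (leqnn k); exists f.
  by rewrite -row_free_unit /row_free Hf.
elim: r => [_|r IH rk].
  exists (fun i : 'I_0 => False_rect T (notF (ltn_ord i))).
  by rewrite flatmx0 mxrank0.
have [f Hf] := IH (ltnW rk); set B := \matrix_(i, j) _ in Hf.
have [t0 At0] : exists t, ~~ (A t <= B)%MS.
  apply: contrapT => /forallNP all_in.
  have /negP : ~~ (row_full B) by rewrite /row_full Hf neq_ltn rk.
  apply; rewrite -cokermx_eq0; apply/eqP/matrixP => i j.
  have H : col j (cokermx B) = 0.
    apply: sep => t; have /negP/negPn := all_in t.
    by rewrite submxE => /eqP ABj; rewrite colE mulmxA ABj mul0mx.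
  by have := congr1 (fun M : 'cV_k => M i 0) H; rewrite !mxE.
rewrite -addn1.
exists (fun i : 'I_(r + 1) => if fintype.split i is inl i' then f i' else t0).
have -> : \matrix_(i, j) A (if fintype.split i is inl i' then f i' else t0) 0 j
    = col_mx B (A t0).
  apply/matrixP => i j; rewrite !mxE; case: fintype.split => i' //=.
    by rewrite mxE.
  by rewrite ord1.
apply/eqP; rewrite eqn_leq rank_leq_row /=.
suff : (\rank B < \rank (col_mx B (A t0)))%N by rewrite Hf -[r.+1]addn1.
rewrite -addsmxE; apply: rank_ltmx; rewrite ltmxE addsmxSl /= addsmx_sub
  submx_refl /=.
exact: At0.
Qed.

Section Bundle.
Context {R : realType} {M : manifold R} {E : vector_bundle M}.
Implicit Types (s t u : forall x, E x) (F : subfamily E) (x y : M).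

Definition smooth_section_at x s := forall i, frame_dom E i x ->
  forall a, smooth_at x (fun y => coord (frame E i y) a (s y)).

Lemma smooth_section_onP (U : set M) s : open U ->
  smooth_section_on U s <-> forall x, U x -> smooth_section_at x s.
Proof.
move=> oU; have oUi i : open (U `&` frame_dom E i).
  by apply: openI => //; exact: frame_dom_open.
split=> [ss x Ux i ix a|ss i a].
  by apply: (smooth_onP _ (oUi i)).1; [exact: ss|split].
by apply/smooth_onP => // x [Ux ix]; exact: ss.
Qed.

Lemma smooth_sectionP s :
  smooth_section_on setT s <-> forall x, smooth_section_at x s.
Proof.
rewrite smooth_section_onP; last exact: openT.
by split=> ss x; [apply: ss|move=> _; apply: ss].
Qed.

Lemma near_section_eq (P : M -> Prop) x s t :
  nbhs x [set y | P y] -> (forall y, P y -> s y = t y) ->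
  smooth_section_at x s -> smooth_section_at x t.
Proof.
move=> nP st ss i ix a; apply: smooth_at_eq (ss i ix a).
by apply: filterS nP => y /st ->.
Qed.

Lemma smooth_section_at0 x : smooth_section_at x (fun=> 0).
Proof.
move=> i ix a; rewrite (_ : (fun y => _) = fun=> 0).
  exact: smooth_at_cst.
by apply/funext => y; rewrite linear0.
Qed.

Lemma smooth_section_atD x s t : smooth_section_at x s ->
  smooth_section_at x t -> smooth_section_at x (fun y => s y + t y).
Proof.
move=> ss st i ix a; under eq_fun do rewrite linearD.
exact: smooth_atD (ss i ix a) (st i ix a).
Qed.

Lemma smooth_section_atZ x (f : M -> R) s : smooth_at x f ->
  smooth_section_at x s -> smooth_section_at x (fun y => f y *: s y).
Proof.
move=> sf ss i ix a; under eq_fun do rewrite linearZ.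
exact: smooth_atM sf (ss i ix a).
Qed.

Lemma smooth_section_atN x s : smooth_section_at x s ->
  smooth_section_at x (fun y => - s y).
Proof.
move=> ss i ix a; under eq_fun do rewrite linearN.
exact: smooth_atN (ss i ix a).
Qed.

Lemma smooth_section_atB x s t : smooth_section_at x s ->
  smooth_section_at x t -> smooth_section_at x (fun y => s y - t y).
Proof. by move=> ss /smooth_section_atN; exact: smooth_section_atD. Qed.

Lemma smooth_section_at_sum x (I : Type) (r : seq I) (G : I -> forall x, E x) :
  (forall i, smooth_section_at x (G i)) ->
  smooth_section_at x (fun y => \sum_(i <- r) G i y).
Proof.
move=> sG; elim: r => [|i r IH].
  move=> j jx a; under eq_fun do rewrite big_nil.
  exact: smooth_section_at0 jx a.
move=> j jx a; under eq_fun do rewrite big_cons.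
exact: smooth_section_atD (sG i) IH j jx a.
Qed.

Lemma smooth_frame i a x : frame_dom E i x ->
  smooth_section_at x (fun y => tnth (frame E i y) a).
Proof.
move=> ix j jx b; exists (frame_dom E i `&` frame_dom E j); split=> //.
  by apply: openI; exact: frame_dom_open.
exact: frame_transition.
Qed.

Lemma frame_dom_nbhs i x : frame_dom E i x -> nbhs x (frame_dom E i).
Proof. by move=> ix; apply: open_nbhs_nbhs; split=> //; exact: frame_dom_open. Qed.

Lemma coord_frame i x (v : E x) : frame_dom E i x ->
  v = \sum_a coord (frame E i x) a v *: tnth (frame E i x) a.
Proof.
move=> /frame_basis/andP[/eqP sp _].
rewrite {1}(@coord_span _ _ _ (frame E i x) v) ?sp ?memvf//.
by apply: eq_bigr => a _; rewrite (tnth_nth 0).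
Qed.

Record smooth_covector (L : forall x, E x -> R) : Prop := SmoothCovector {
  covector_linear : forall x a (u v : E x), L x (a *: u + v) = a * L x u + L x v;
  covector_frame : forall i x, frame_dom E i x ->
    forall a, smooth_at x (fun y => L y (tnth (frame E i y) a)) }.

Lemma covector_sum (L : forall x, E x -> R) x : smooth_covector L ->
  forall k (c : 'I_k -> R) (v : 'I_k -> E x),
  L x (\sum_a c a *: v a) = \sum_a c a * L x (v a).
Proof.
move=> sL k c v; have L0 : L x 0 = 0.
  have := covector_linear sL 1 (0 : E x) 0; rewrite scaler0 addr0 mul1r.
  exact: self_double_eq0.
elim/big_rec2: _ => [//|i r w _ <-].
by rewrite (covector_linear sL).
Qed.

Lemma smooth_covector_at L x s : smooth_covector L ->
  smooth_section_at x s -> smooth_at x (fun y => L y (s y)).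
Proof.
move=> sL ss; have [i ix] := frame_cover E x.
have E1 : \forall y \near x,
    \sum_a coord (frame E i y) a (s y) * L y (tnth (frame E i y) a) = L y (s y).
  apply: filterS (frame_dom_nbhs ix) => y iy.
  by rewrite {2}(coord_frame (s y) iy) (covector_sum sL).
apply: (smooth_at_eq E1); apply: smooth_at_sum => a _.
by apply: smooth_atM; [exact: ss|exact: covector_frame].
Qed.

Lemma subbundle_vspace F : subbundle F ->
  forall x, exists V : {vspace E x}, F x = [set` V].
Proof.
move=> sF x; have [U [k [t [_ Ux _ /(_ _ Ux)[_ Fx]]]]] := sF x.
by exists <<t x>>%VS.
Qed.

Lemma subbundle0 F x : subbundle F -> F x 0.
Proof. by move=> /subbundle_vspace /(_ x)[V ->]; exact: mem0v. Qed.

Lemma subbundleP F x a (u v : E x) : subbundle F -> F x u -> F x v ->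
  F x (a *: u + v).
Proof.
move=> /subbundle_vspace /(_ x)[V ->] /= uV vV.
by rewrite memvD// memvZ.
Qed.

Lemma subbundleZ F x a (u : E x) : subbundle F -> F x u -> F x (a *: u).
Proof.
by move=> sF Fu; rewrite -[_ *: _]addr0; apply: subbundleP => //; exact: subbundle0.
Qed.

Lemma subbundleD F x (u v : E x) : subbundle F -> F x u -> F x v -> F x (u + v).
Proof. by move=> sF Fu Fv; rewrite -[u]scale1r; exact: subbundleP. Qed.

Lemma subbundleN F x (u : E x) : subbundle F -> F x u -> F x (- u).
Proof. by move=> sF Fu; rewrite -scaleN1r; exact: subbundleZ. Qed.

Lemma subbundleB F x (u v : E x) : subbundle F -> F x u -> F x v -> F x (u - v).
Proof. by move=> sF Fu Fv; apply: subbundleD => //; exact: subbundleN. Qed.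

Lemma cutoff_section (U K : set M) (phi : M -> R) s : open U -> closed K ->
  K `<=` U -> smooth phi -> (forall y, ~ K y -> phi y = 0) ->
  (forall x, U x -> smooth_section_at x s) ->
  forall x, smooth_section_at x (fun y => phi y *: s y).
Proof.
move=> oU cK KU /smoothP sphi phi0 ss x; have [Kx|Kx] := pselect (K x).
  by apply: smooth_section_atZ => //; apply: ss; exact: KU.
have nK : nbhs x [set y | ~ K y].
  by apply: open_nbhs_nbhs; split=> //; exact: closed_openC.
apply: (near_section_eq nK (s := fun=> 0)); last exact: smooth_section_at0.
by move=> y nKy; rewrite phi0// scale0r.
Qed.

Lemma cutoff_function (U K : set M) (phi f : M -> R) : open U -> closed K ->
  K `<=` U -> smooth phi -> (forall y, ~ K y -> phi y = 0) ->
  (forall x, U x -> smooth_at x f) -> smooth (fun y => phi y * f y).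
Proof.
move=> oU cK KU /smoothP sphi phi0 sf; apply/smoothP => x.
have [Kx|Kx] := pselect (K x).
  by apply: smooth_atM => //; apply: sf; exact: KU.
have E1 : \forall y \near x, 0 = phi y * f y.
  have : nbhs x [set y | ~ K y].
    by apply: open_nbhs_nbhs; split=> //; exact: closed_openC.
  by apply: filterS => y nKy; rewrite phi0// mul0r.
by apply: (smooth_at_eq E1); exact: smooth_at_cst.
Qed.

(** A combination of a local frame with constant coefficients, cut off by a bump
    function. *)
Lemma extend_to_section F x v : subbundle F -> F x v ->
  exists s, section F s /\ s x = v.
Proof.
move=> sF Fv; have [U [k [t [oU Ux st tF]]]] := sF x.
have [phi [K [sphi phix cK KU phi0]]] := bump_function oU Ux.
have [_ Fx] := tF _ Ux; have vt : v \in <<t x>>%VS by move: Fv; rewrite Fx.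
pose s y := \sum_a coord (t x) a v *: tnth (t y) a.
have ss y : U y -> smooth_section_at y s.
  move=> Uy; apply: smooth_section_at_sum => a; apply: smooth_section_atZ.
    exact: smooth_at_cst.
  by have [+ _] := smooth_section_onP (fun y => tnth (t y) a) oU; apply.
exists (fun y => phi y *: s y); split; last first.
  rewrite phix scale1r /s [RHS](coord_span vt).
  by apply: eq_bigr => a _; rewrite (tnth_nth 0).
split; first by apply/smooth_sectionP; exact: cutoff_section oU cK KU _ _ _.
move=> y; have [Ky|Ky] := pselect (K y); last first.
  by rewrite phi0// scale0r; exact: subbundle0.
apply: subbundleZ => //; have [_ ->] := tF _ (KU _ Ky); rewrite /=.
by apply: memv_suml => a _; rewrite memvZ// memv_span// mem_tnth.
Qed.

(** Near a point, finitely many of the covectors already separate the fibers of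
    [F]; Cramer's rule then expresses the coefficients of [u] in a local frame of
    [F] by the smooth functions [L i (u)].  Lifts, projections and sections that
    are defined by duality are all shown to be smooth in this way. *)
Lemma smooth_of_covectors F (T : Type) (L : T -> forall x, E x -> R) u :
  subbundle F -> (forall x, F x (u x)) -> (forall i, smooth_covector (L i)) ->
  (forall x (w : E x), F x w -> (forall i, L i x w = 0) -> w = 0) ->
  (forall i x, smooth_at x (fun y => L i y (u y))) ->
  forall x, smooth_section_at x u.
Proof.
move=> sF Fu sL sep sLu x; have [U [k [t [oU Ux st tF]]]] := sF x.
have sta a y : U y -> smooth_section_at y (fun y => tnth (t y) a).
  by have [+ _] := smooth_section_onP (fun y => tnth (t y) a) oU; apply.
have [tfree Fx] := tF _ Ux.
have [f Hf] : exists f : 'I_k -> T,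
    \matrix_(i, j) (\row_a L (f i) x (tnth (t x) a)) 0 j \in unitmx.
  apply: (select_invertible (A := fun i => \row_a L i x (tnth (t x) a))) => w Hw.
  have : \sum_a w a 0 *: tnth (t x) a = 0.
    apply: (sep x).
      by rewrite Fx /= memv_suml// => a _; rewrite memvZ// memv_span// mem_tnth.
    move=> i; rewrite (covector_sum (sL i)).
    have := congr1 (fun B : 'M[R]_(1, 1) => B 0 0) (Hw i).
    rewrite !mxE; apply: etrans.
    by apply: eq_bigr => a _; rewrite mxE mulrC.
  under eq_bigr do rewrite (tnth_nth 0).
  move/freeP: tfree => /[apply] w0; apply/matrixP => a j.
  by rewrite ord1 w0 mxE.
pose A y : 'M[R]_k := \matrix_(i, j) L (f i) y (tnth (t y) j).
have sA i j : smooth_at x (fun y => A y i j).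
  rewrite (_ : (fun y => _) = fun y => L (f i) y (tnth (t y) j)).
    by apply: smooth_covector_at => //; exact: sta.
  by apply/funext => y; rewrite mxE.
have dA := smooth_at_det sA.
have dAx : \det (A x) != 0.
  move: Hf; rewrite unitmxE unitfE; apply: contra => /eqP <-.
  by apply/eqP; congr (\det _); apply/matrixP => i j; rewrite !mxE.
pose P y := U y /\ \det (A y) != 0.
have nP : nbhs x [set y | P y].
  apply: filterI; first by apply: open_nbhs_nbhs; split.
  exact: smooth_at_neq0.
pose c a y := (\det (A y))^-1 * \sum_b (\adj (A y)) a b * L (f b) y (u y).
apply: (near_section_eq (P := P) (s := fun y => \sum_a c a y *: tnth (t y) a) nP).
  move=> y [Uy dAy]; have [_ Fy] := tF _ Uy.
  have ut : u y \in <<t y>>%VS by have := Fu y; rewrite Fy.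
  rewrite [RHS](coord_span ut); apply: eq_bigr => a _; rewrite (tnth_nth 0).
  congr (_ *: _); pose cv := \col_a coord (t y) a (u y).
  have Acv b : L (f b) y (u y) = (A y *m cv) b 0.
    rewrite {1}(coord_span ut) (covector_sum (sL _)) mxE.
    by apply: eq_bigr => j _; rewrite !mxE mulrC (tnth_nth 0).
  have -> : c a y = (\det (A y))^-1 * (\adj (A y) *m (A y *m cv)) a 0.
    rewrite /c [in RHS]mxE; congr (_ * _).
    by apply: eq_bigr => b _; rewrite Acv.
  by rewrite mulmxA mul_adj_mx mul_scalar_mx !mxE mulrA mulVf// mul1r.
apply: smooth_section_at_sum => a; apply: smooth_section_atZ; last exact: sta.
apply: smooth_atM; first exact: smooth_atV.
by apply: smooth_at_sum => b _; apply: smooth_atM => //; exact: smooth_at_adj.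
Qed.

(** Some minor of the matrix of coordinates is nonzero at [x], hence near [x]. *)
Lemma free_near k (t : forall y, k.-tuple (E y)) x :
  (forall a, smooth_section_at x (fun y => tnth (t y) a)) -> free (t x) ->
  \near x, free (t x).
Proof.
move=> st ft; have [i ix] := frame_cover E x.
have [f Hf] : exists f : 'I_k -> 'I_(frame_rank E i),
    \matrix_(p, j) (\row_a coord (frame E i x) (f p) (tnth (t x) a)) 0 j
      \in unitmx.
  apply: (select_invertible
    (A := fun b => \row_a coord (frame E i x) b (tnth (t x) a))) => w Hw.
  have : \sum_a w a 0 *: tnth (t x) a = 0.
    rewrite [LHS](coord_frame _ ix) big1// => b _.
    rewrite (_ : coord _ _ _ = 0) ?scale0r// linear_sum /=.
    have := congr1 (fun B : 'M[R]_(1, 1) => B 0 0) (Hw b).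
    rewrite !mxE; apply: etrans.
    by apply: eq_bigr => a _; rewrite linearZ mxE mulrC.
  under eq_bigr do rewrite (tnth_nth 0).
  move/freeP: ft => /[apply] w0; apply/matrixP => a j.
  by rewrite ord1 w0 mxE.
pose A y : 'M[R]_k := \matrix_(p, j) coord (frame E i y) (f p) (tnth (t y) j).
have sA p j : smooth_at x (fun y => A y p j).
  rewrite (_ : (fun y => _) = fun y => coord (frame E i y) (f p) (tnth (t y) j)).
    exact: st.
  by apply/funext => y; rewrite mxE.
have dAx : \det (A x) != 0.
  move: Hf; rewrite unitmxE unitfE; apply: contra => /eqP <-.
  by apply/eqP; congr (\det _); apply/matrixP => p j; rewrite !mxE.
have : nbhs x [set y | \det (A y) != 0].
  exact: (smooth_at_neq0 (smooth_at_det sA)).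
apply: filterS => y /= dAy; apply/freeP => c c0 a.
have Ac : A y *m (\col_a c a) = 0.
  apply/matrixP => p j; rewrite !mxE ord1.
  have := congr1 (coord (frame E i y) (f p)) c0.
  rewrite linear0 linear_sum; apply: etrans.
  by apply: eq_bigr => b _; rewrite !mxE linearZ mulrC (tnth_nth 0).
have uA : A y \in unitmx by rewrite unitmxE unitfE.
have := congr1 (mulmx (invmx (A y))) Ac; rewrite mulKmx// mulmx0.
by move/(congr1 (fun B : 'cV[R]_k => B a 0)); rewrite !mxE.
Qed.

End Bundle.

(** * Linear algebra of the fibers *)

Section LinearAlgebra.
Context {R : realType} {V : vectType R}.
Implicit Types (b : {biscalar V}) (S A B : set V).

(** A subspace of maximal dimension inside [S] exhausts [S]. *)
Lemma vspace_of_closed S : S 0 ->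
  (forall (a : R) u v, S u -> S v -> S (a *: u + v)) ->
  exists W : {vspace V}, S = [set` W].
Proof.
move=> S0 Slin.
pose D n := `[< exists W : {vspace V}, [set` W] `<=` S /\ \dim W = n >].
have D0 : exists n, D n.
  exists 0%N; apply/asboolP; exists 0%VS; split; last by rewrite dimv0.
  by move=> u /=; rewrite memv0 => /eqP ->.
have Dle n : D n -> (n <= \dim {:V})%N.
  by move=> /asboolP[W [_ <-]]; exact: dimvS (subvf _).
have := ex_maxnP D0 Dle; case=> n /asboolP[W [WS dW]] nmax.
exists W; apply/seteqP; split=> // v Sv /=; apply: contrapT => /negP vW.
have /nmax : D (\dim (W + <[v]>)%VS).
  apply/asboolP; exists (W + <[v]>)%VS; split=> //.
  move=> u /= /memv_addP[w wW [_ /vlineP[a ->] ->]].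
  by rewrite addrC; apply: Slin => //; exact: WS.
apply/negP; rewrite -ltnNge -dW.
rewrite ltn_neqAle dimvS ?addvSl// andbT; apply: contra vW => dE.
have /eqP -> : W == (W + <[v]>)%VS by rewrite eqEdim addvSl/= (eqP dE).
by apply: (subvP (addvSr W _)); exact: memv_line.
Qed.

Lemma biscalar_sumr b k (c : 'I_k -> R) u (v : 'I_k -> V) :
  b u (\sum_i c i *: v i) = \sum_i c i * b u (v i).
Proof.
by rewrite linear_sumr /=; apply: eq_bigr => i _; rewrite linearZr_LR.
Qed.

Lemma biscalar_suml b k (c : 'I_k -> R) (u : 'I_k -> V) v :
  b (\sum_i c i *: u i) v = \sum_i c i * b (u i) v.
Proof.
by rewrite linear_sumlz; apply: eq_bigr => i _; rewrite linearZl_LR.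
Qed.

(** Inversion of the Gram matrix. *)
Lemma riesz b (phi : V -> R) : (forall u, (forall v, b u v = 0) -> u = 0) ->
  (forall a u v, phi (a *: u + v) = a * phi u + phi v) ->
  exists u, forall v, b u v = phi v.
Proof.
move=> nd lin; pose X := vbasis {:V}.
pose phiL := GRing.isLinear.Build R V R *%R phi lin.
pose phi' : {scalar V} := HB.pack phi phiL.
pose G : 'M[R]_(\dim {:V}) := \matrix_(i, j) b X`_i X`_j.
have XE v : v = \sum_i coord X i v *: X`_i by apply: coord_vbasis; rewrite memvf.
have uG : G \in unitmx.
  rewrite -row_free_unit -kermx_eq0; apply/eqP/row_matrixP => k.
  set w := row k _; have wG : w *m G = 0 by rewrite -row_mul mulmx_ker linear0.
  rewrite linear0; have : \sum_i w 0 i *: X`_i = 0.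
    apply: nd => v; rewrite (XE v) biscalar_sumr big1// => j _.
    rewrite biscalar_suml -[RHS](mulr0 (coord X j v)); congr (_ * _).
    have /rowP /(_ j) := wG; rewrite !mxE; apply: etrans.
    by apply: eq_bigr => i _; rewrite [G i j]mxE.
  move/freeP: (basis_free (vbasisP {:V})) => /[apply] w0.
  by apply/rowP => i; rewrite w0 mxE.
pose w := (\row_j phi X`_j) *m invmx G.
exists (\sum_i w 0 i *: X`_i) => v.
rewrite (XE v) biscalar_sumr -[phi]/(phi' : V -> R) linear_sum.
apply: eq_bigr => j _; rewrite linearZ /= biscalar_suml; congr (_ * _).
have : w *m G = \row_j phi X`_j by rewrite mulmxKV.
move/rowP => /(_ j); rewrite [in RHS]mxE => <-; rewrite mxE.
by apply: eq_bigr => i _; rewrite [G i j]mxE.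
Qed.

(** Two isotropic subspaces in duality have dual bases [a_i], [b_i]; the
    vectors [a_i + b_i] and [a_i - b_i] span a positive and a negative definite
    subspace. *)
Lemma neutral_of_isotropic b A B :
  (forall u v, b u v = b v u) ->
  A 0 -> (forall (a : R) u v, A u -> A v -> A (a *: u + v)) ->
  B 0 -> (forall (a : R) u v, B u -> B v -> B (a *: u + v)) ->
  (forall u v, A u -> A v -> b u v = 0) ->
  (forall u v, B u -> B v -> b u v = 0) ->
  (forall u, A u -> (forall v, B v -> b u v = 0) -> u = 0) ->
  (forall v, B v -> (forall u, A u -> b u v = 0) -> v = 0) ->
  exists U W : {vspace V},
  [/\ [set u + v | u in A & v in B] = [set` (U + W)%VS], \dim U = \dim W,
      forall v w, v \in U -> w \in W -> b v w = 0,
      forall v, v \in U -> v != 0 -> 0 < b v v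
    & forall w, w \in W -> w != 0 -> b w w < 0].
Proof.
move=> sym A0 Alin B0 Blin Aiso Biso Asep Bsep.
have [VA AE] := vspace_of_closed A0 Alin; subst A.
have [VB BE] := vspace_of_closed B0 Blin; subst B.
rewrite /= in Aiso Biso Asep Bsep.
pose k := \dim VA; pose X := vbasis VA.
have Xin i : X`_i \in VA.
  have [ik|ik] := ltnP i k; last by rewrite nth_default ?size_tuple// mem0v.
  by apply: vbasis_mem; rewrite mem_nth ?size_tuple.
have fX : free X := basis_free (vbasisP VA).
have [f Hf] : exists f : 'I_k -> {w | w \in VB},
    \matrix_(i, j) (\row_(a < k) b X`_a (sval (f i))) 0 j \in unitmx.
  apply: (select_invertible
    (A := fun w : {w | w \in VB} => \row_(a < k) b X`_a (sval w))) => w Hw.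
  have : \sum_a w a 0 *: X`_a = 0.
    apply: Asep; first by apply: memv_suml => a _; rewrite memvZ.
    move=> v Bv; rewrite biscalar_suml.
    have := congr1 (fun B : 'M[R]_(1, 1) => B 0 0) (Hw (exist _ v Bv)).
    rewrite !mxE; apply: etrans.
    by apply: eq_bigr => a _; rewrite mxE mulrC.
  move/freeP: fX => /[apply] w0; apply/matrixP => a j.
  by rewrite ord1 w0 mxE.
set G := (X in X \in unitmx) in Hf.
pose Y j := \sum_i invmx G j i *: sval (f i).
have Yin j : Y j \in VB.
  by apply: memv_suml => i _; rewrite memvZ//; exact: svalP (f i).
have XY (l j : 'I_k) : b X`_l (Y j) = (j == l)%:R.
  have : (invmx G *m G) j l = (j == l)%:R by rewrite mulVmx// mxE.
  rewrite mxE => <-; rewrite biscalar_sumr.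
  by apply: eq_bigr => i _; rewrite !mxE.
have YX (l j : 'I_k) : b (Y j) X`_l = (j == l)%:R by rewrite sym XY.
pose Z (e : R) := [tuple X`_i + e *: Y i | i < k].
have ZE e (i : 'I_k) : (Z e)`_i = X`_i + e *: Y i.
  by rewrite -tnth_nth tnth_mktuple.
have bZ e e' (i j : 'I_k) : b (Z e)`_i (Z e')`_j = (i == j)%:R * (e + e').
  rewrite !ZE linearDl /= linearDr /= linearDr /= !linearZl_LR /= !linearZr_LR /=.
  rewrite (Aiso _ _ (Xin i) (Xin j)) XY YX (Biso _ _ (Yin i) (Yin j)).
  by rewrite [j == i]eq_sym /GRing.scale /=; ring.
have bZs e e' (c c' : 'I_k -> R) :
    b (\sum_i c i *: (Z e)`_i) (\sum_i c' i *: (Z e')`_i) =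
    (e + e') * \sum_i c i * c' i.
  rewrite biscalar_suml mulr_sumr; apply: eq_bigr => i _.
  rewrite biscalar_sumr (bigD1 i)//= bZ eqxx mul1r big1 ?addr0; first by ring.
  by move=> j ji; rewrite bZ eq_sym (negPf ji) mul0r mulr0.
have fZ (e : R) : e != 0 -> free (Z e).
  move=> e0; apply/freeP => c c0 i.
  have : b (\sum_i c i *: (Z e)`_i) (\sum_i c i *: (Z e)`_i) = 0.
    by rewrite c0 linear0l.
  rewrite bZs => /eqP; rewrite mulf_eq0 -mulr2n mulrn_eq0 (negPf e0) /=.
  rewrite psumr_eq0 => [/allP /(_ i)|j _]; last by rewrite -expr2 sqr_ge0.
  by rewrite mem_index_enum mulf_eq0 orbb => /(_ isT) /eqP.
have sZ e v : v \in <<Z e>>%VS ->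
    exists c : 'I_k -> R, v = \sum_i c i *: (Z e)`_i.
  by move=> /coord_span vE; exists (fun i => coord (Z e) i v).
have half (u : V) : 2^-1 *: (u + u) = u.
  by rewrite -mulr2n -[u *+ 2]scaler_nat scalerA mulVf ?scale1r// pnatr_eq0.
have sq_gt0 e (c : 'I_k -> R) : \sum_i c i *: (Z e)`_i != 0 ->
    0 < \sum_i c i * c i.
  move=> v0; rewrite lt0r sumr_ge0 ?andbT => [|i _]; last by rewrite -expr2 sqr_ge0.
  apply: contra v0 => /eqP c0.
  rewrite big1// => i _; rewrite (_ : c i = 0) ?scale0r//.
  have : \sum_i c i * c i == 0 by apply/eqP.
  rewrite psumr_eq0 => [/allP /(_ i)|j _]; last by rewrite -expr2 sqr_ge0.
  by rewrite mem_index_enum mulf_eq0 orbb => /(_ isT) /eqP.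
have e1 : (1 : R) != 0 by rewrite oner_eq0.
have eN1 : (-1 : R) != 0 by rewrite oppr_eq0.
have ZVB e (i : 'I_k) : (Z e)`_i \in (VA + VB)%VS.
  by rewrite ZE memv_add// memvZ.
exists <<Z 1>>%VS, <<Z (-1)>>%VS; split.
- have XZ (i : 'I_k) : X`_i \in (<<Z 1>> + <<Z (-1)>>)%VS.
    have -> : X`_i = 2^-1 *: (Z 1)`_i + 2^-1 *: (Z (-1))`_i.
      by rewrite !ZE -scalerDr scale1r scaleN1r addrACA subrr addr0 half.
    by apply: memv_add; rewrite memvZ// memv_span// mem_nth ?size_tuple.
  have YZ (i : 'I_k) : Y i \in (<<Z 1>> + <<Z (-1)>>)%VS.
    have -> : Y i = 2^-1 *: (Z 1)`_i - 2^-1 *: (Z (-1))`_i.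
      by rewrite !ZE -scalerBr scale1r scaleN1r opprB addrC addrA subrK half.
    apply: memv_add; last rewrite memvN.
      by rewrite memvZ// memv_span// mem_nth ?size_tuple.
    by rewrite memvZ// memv_span// mem_nth ?size_tuple.
  have sub e : (<<Z e>> <= VA + VB)%VS.
    apply/span_subvP => u /(nthP 0)[i]; rewrite size_tuple => ik <-.
    exact: (ZVB e (Ordinal ik)).
  apply/seteqP; split=> [_ [u uA [v vB <-]]|w] /=.
    rewrite memvD//; last first.
      have -> : v = \sum_(i < k) b X`_i v *: Y i.
        apply/eqP; rewrite -subr_eq0; apply/eqP/Bsep.
          by rewrite memvB//; apply: memv_suml => i _; rewrite memvZ.
        move=> a aA; rewrite (coord_vbasis aA) biscalar_suml big1// => i _.
        rewrite linearBr /= biscalar_sumr (bigD1 i)//= XY eqxx mulr1 big1.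
          by rewrite addr0 subrr mulr0.
        by move=> j ji; rewrite XY (negPf ji) mulr0.
      by apply: memv_suml => i _; rewrite memvZ.
    by rewrite (coord_vbasis uA); apply: memv_suml => i _; rewrite memvZ.
  have H : (<<Z 1>> + <<Z (-1)>> <= VA + VB)%VS by rewrite subv_add !sub.
  by move=> /(subvP H) /memv_addP[u uA [v vB ->]]; exists u => //; exists v.
- have d (e : R) : e != 0 -> \dim <<Z e>>%VS = k.
    by move=> /fZ; rewrite /free => /eqP ->; rewrite size_tuple.
  by rewrite !d.
- by move=> v w /sZ[c ->] /sZ[c' ->]; rewrite bZs addrN mul0r.
- move=> v /sZ[c ->] v0; rewrite bZs pmulr_rgt0 ?addr_gt0//; exact: sq_gt0 v0.
- move=> v /sZ[c ->] v0; rewrite bZs -opprD mulNr oppr_lt0.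
  by rewrite pmulr_rgt0 ?addr_gt0//; exact: sq_gt0 v0.
Qed.

End LinearAlgebra.

(** * Tangent vectors as derivations *)

Section TangentVectors.
Context {R : realType} {M : manifold R}.
Implicit Types (x : M) (f h : M -> R).

Lemma tangentE x (v : tangent x) : derivation_at x v.
Proof. by case: v => v /= /asboolP. Qed.

Lemma tangent_ext x (v w : tangent x) : (forall f, smooth f -> v f = w f) -> v = w.
Proof.
move=> vw; apply: val_inj; apply/funext => f /=.
have [sf|nsf] := pselect (smooth f); first exact: vw.
by have [-> // _ _] := tangentE v; have [-> // _ _] := tangentE w.
Qed.

Lemma tangent_lin x (a : R) (v w : tangent x) f :
  (a *: v + w : tangent x) f = a * v f + w f.
Proof. by []. Qed.

Lemma tangent_add x (v : tangent x) f h : smooth f -> smooth h ->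
  v (fun y => f y + h y) = v f + v h.
Proof.
move=> sf sh; have [_ lin _] := tangentE v.
have := lin 1 f h sf sh; rewrite mul1r => <-; congr (v _).
by apply/funext => y; rewrite fctE /= !fctE /GRing.scale /= mul1r.
Qed.

Lemma tangent_zero x (v : tangent x) : v (fun=> 0) = 0.
Proof.
have := tangent_add v (smooth_cst 0) (smooth_cst 0).
under eq_fun do rewrite addr0.
by move/self_double_eq0.
Qed.

Lemma tangent_scale x (v : tangent x) a f : smooth f ->
  v (fun y => a * f y) = a * v f.
Proof.
move=> sf; have [_ lin _] := tangentE v.
rewrite -[a * v f]addr0 -[in RHS](tangent_zero v) -(lin a f _ sf (smooth_cst 0)).
by congr (v _); apply/funext => y; rewrite fctE /= !fctE addr0.
Qed.

Lemma tangent_sub x (v : tangent x) f h : smooth f -> smooth h ->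
  v (fun y => f y - h y) = v f - v h.
Proof.
move=> sf sh; have sNh : smooth (fun y => - 1 * h y).
  exact: (smoothM (smooth_cst (-1)) sh).
rewrite -mulN1r -tangent_scale// -tangent_add//.
by congr (v _); apply/funext => y; rewrite mulN1r.
Qed.

(** The image of the coboundary is defined with bundled linear forms. *)
Lemma linear_on_pack x (alpha : tangent x -> R) :
  (forall a u v, alpha (a *: u + v) = a * alpha u + alpha v) ->
  exists alpha' : {scalar tangent x}, alpha' = alpha :> (tangent x -> R).
Proof.
move=> lin; pose aL := GRing.isLinear.Build R (tangent x) R *%R alpha lin.
by exists (HB.pack alpha aL : {scalar tangent x}).
Qed.

End TangentVectors.

(** * Metrics and anchors *)

Section MetricAnchor.
Context {R : realType} {M : manifold R} {E : vector_bundle M}.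
Context (g : metric E) (rho : anchor E).
Implicit Types (s t : forall x, E x) (F : subfamily E) (x y : M).

Lemma gDl x (u v w : E x) : g x (u + v) w = g x u w + g x v w.
Proof. by rewrite linearDl. Qed.
Lemma gDr x (u v w : E x) : g x u (v + w) = g x u v + g x u w.
Proof. by rewrite linearDr. Qed.
Lemma gBl x (u v w : E x) : g x (u - v) w = g x u w - g x v w.
Proof. by rewrite linearBl. Qed.
Lemma gBr x (u v w : E x) : g x u (v - w) = g x u v - g x u w.
Proof. by rewrite linearBr. Qed.
Lemma gNl x (u w : E x) : g x (- u) w = - g x u w.
Proof. by rewrite linearNl. Qed.
Lemma gNr x (u w : E x) : g x u (- w) = - g x u w.
Proof. by rewrite linearNr. Qed.
Lemma gZl x a (u w : E x) : g x (a *: u) w = a * g x u w.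
Proof. by rewrite linearZl_LR. Qed.
Lemma gZr x a (u w : E x) : g x u (a *: w) = a * g x u w.
Proof. by rewrite linearZr_LR. Qed.
Lemma g0l x (w : E x) : g x 0 w = 0.
Proof. by rewrite linear0l. Qed.
Lemma smooth_metric x s t : smooth_section_at x s -> smooth_section_at x t ->
  smooth_at x (fun y => g y (s y) (t y)).
Proof.
move=> ss st; have [i ix] := frame_cover E x.
have E1 : \forall y \near x,
    \sum_a coord (frame E i y) a (s y) * (\sum_b coord (frame E i y) b (t y) *
      g y (tnth (frame E i y) a) (tnth (frame E i y) b)) = g y (s y) (t y).
  apply: filterS (frame_dom_nbhs ix) => y iy.
  rewrite [in RHS](coord_frame (s y) iy) biscalar_suml; apply: eq_bigr => a _.
  by congr (_ * _); rewrite [in RHS](coord_frame (t y) iy) biscalar_sumr.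
apply: (smooth_at_eq E1); apply: smooth_at_sum => a _.
apply: smooth_atM; first exact: ss.
apply: smooth_at_sum => b _; apply: smooth_atM; first exact: st.
by apply: (smooth_onP _ (frame_dom_open i)).1 ix; exact: metric_smooth.
Qed.

Lemma metric_covector s : (forall x, smooth_section_at x s) ->
  smooth_covector (fun y u => g y u (s y)).
Proof.
move=> ss; split=> [x a u v|i x ix a]; first by rewrite gDl gZl.
by apply: smooth_metric => //; exact: smooth_frame.
Qed.

Lemma anchor_covector f : smooth f -> smooth_covector (fun y u => rho y u f).
Proof.
move=> sf; split=> [x a u v|i x ix a]; first by rewrite linearP tangent_lin.
by apply: (smooth_onP _ (frame_dom_open i)).1 ix; exact: anchor_smooth.
Qed.

Lemma smooth_metric_section F G s t : section F s -> section G t ->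
  smooth (fun y => g y (s y) (t y)).
Proof.
move=> [/smooth_sectionP ss _] [/smooth_sectionP st _].
by apply/smoothP => x; exact: smooth_metric.
Qed.

Lemma anchor_vector_field F s : section F s -> vector_field (fun x => rho x (s x)).
Proof.
move=> [/smooth_sectionP ss _] f sf; apply/smoothP => x.
exact: (smooth_covector_at (anchor_covector sf)).
Qed.

Lemma section_full F s : section F s -> section (full E) s.
Proof. by case. Qed.

Lemma sectionD F s t : subbundle F -> section F s -> section F t ->
  section F (fun y => s y + t y).
Proof.
move=> sF [/smooth_sectionP ss Fs] [/smooth_sectionP st Ft]; split.
  by apply/smooth_sectionP => x; exact: smooth_section_atD.
by move=> x; exact: subbundleD.
Qed.

Lemma sectionN F s : subbundle F -> section F s -> section F (fun y => - s y).
Proof.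
move=> sF [/smooth_sectionP ss Fs]; split.
  by apply/smooth_sectionP => x; exact: smooth_section_atN.
by move=> x; exact: subbundleN.
Qed.

Lemma sectionB F s t : subbundle F -> section F s -> section F t ->
  section F (fun y => s y - t y).
Proof. by move=> sF ss /(sectionN sF); exact: sectionD. Qed.

Lemma sectionZ F f s : subbundle F -> smooth f -> section F s ->
  section F (fun y => f y *: s y).
Proof.
move=> sF /smoothP sf [/smooth_sectionP ss Fs]; split.
  by apply/smooth_sectionP => x; exact: smooth_section_atZ.
by move=> x; exact: subbundleZ.
Qed.

Lemma sectionZc F a s : subbundle F -> section F s ->
  section F (fun y => a *: s y).
Proof. by move=> sF; exact: (sectionZ sF (smooth_cst a)). Qed.

Lemma section0 F : subbundle F -> section F (fun=> 0).
Proof.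
move=> sF; split; last by move=> x; exact: subbundle0.
by apply/smooth_sectionP => x; exact: smooth_section_at0.
Qed.

Hypothesis nondeg : forall x u, (forall v, g x u v = 0) -> u = 0.

Notation dd := (partial g rho (full E)).

Lemma sharp_fullP x (phi : E x -> R) :
  (forall a u v, phi (a *: u + v) = a * phi u + phi v) ->
  forall e, g x (sharp g (full E) phi) e = phi e.
Proof.
move=> lin; have [u Hu] := riesz (nondeg (x := x)) lin.
rewrite /sharp; case: xgetP => [v _ /= [_ Hv] e|]; first exact: Hv.
by move/(_ u) => []; split.
Qed.

Lemma partialE x (alpha : tangent x -> R) :
  (forall a u v, alpha (a *: u + v) = a * alpha u + alpha v) ->
  forall e, g x (dd alpha) e = 2^-1 * alpha (rho x e).
Proof.
move=> lin e; rewrite gZl sharp_fullP// => a u v.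
by rewrite linearP lin.
Qed.

Lemma metric_inj x (u v : E x) : (forall w, g x u w = g x v w) -> u = v.
Proof.
move=> uv; apply/eqP; rewrite -subr_eq0; apply/eqP/nondeg => w.
by rewrite gBl uv subrr.
Qed.

Lemma partial_funE f x e :
  g x (partial_fun g rho (full E) f x) e = 2^-1 * rho x e f.
Proof. by rewrite partialE. Qed.

Lemma partial_imP x u : partial_im g rho (full E) x u <->
  exists2 alpha : tangent x -> R,
    (forall a v w, alpha (a *: v + w) = a * alpha v + alpha w) & u = dd alpha.
Proof.
split=> [[alpha ->]|[alpha lin ->]].
  by exists alpha => // a v w; rewrite linearP.
by have [alpha' E1] := linear_on_pack lin; exists alpha'; rewrite E1.
Qed.

Lemma partial_fun_im f x :
  partial_im g rho (full E) x (partial_fun g rho (full E) f x).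
Proof. by apply/partial_imP; exists (fun v : tangent x => v f). Qed.

Lemma partial_im_ker x u e : partial_im g rho (full E) x u -> rho x e = 0 ->
  g x u e = 0.
Proof.
move=> [alpha ->] re; rewrite partialE => [|a v w]; last by rewrite linearP.
by rewrite re linear0 mulr0.
Qed.

Hypothesis isot : isotropic g (partial_im g rho (full E)).

(** Isotropy of the image of the coboundary is tested against differentials of
    functions, which separate tangent vectors. *)
Lemma anchor_partial_im x u : partial_im g rho (full E) x u -> rho x u = 0.
Proof.
move=> du; apply: tangent_ext => f sf.
have := isot (partial_fun_im f x) du.
by rewrite partial_funE => /eqP; rewrite mulf_eq0 invr_eq0 pnatr_eq0 /= => /eqP.
Qed.

Hypothesis surj : surjective_anchor rho.

(** A vector orthogonal to the kernel of the anchor pairs with [E] through the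
    anchor; as the anchor is onto, this pairing is a linear form on the tangent
    space. *)
Lemma partial_im_orthP x u : partial_im g rho (full E) x u <->
  (forall e, rho x e = 0 -> g x u e = 0).
Proof.
split=> [du e|H]; first exact: partial_im_ker.
have /choice[lift Hl] : forall v : tangent x, exists e, rho x e = v by exact: surj.
have gl e : g x u e = g x u (lift (rho x e)).
  by apply/eqP; rewrite -subr_eq0 -gBr H// linearB /= Hl subrr.
have lin a v w : 2 * g x u (lift (a *: v + w)) =
    a * (2 * g x u (lift v)) + 2 * g x u (lift w).
  have := gl (a *: lift v + lift w); rewrite [rho x _]linearP !Hl gDr gZr => <-; ring.
apply/partial_imP; exists (fun v => 2 * g x u (lift v)) => //.
apply: metric_inj => e; rewrite partialE//.
by rewrite -gl mulrA mulVf ?mul1r// pnatr_eq0.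
Qed.

End MetricAnchor.

(** * Bilinearity of Courant brackets *)

Section Brackets.
Context {R : realType} {M : manifold R} {E : vector_bundle M}.
Context {g : metric E} {rho : anchor E} {F : subfamily E}.
Arguments F : clear implicits.
Implicit Types (e : forall x, E x) (x : M).

Hypothesis sF : subbundle F.
Variable br : (forall x, E x) -> (forall x, E x) -> forall x, E x.
Hypothesis hbr : courant_bracket g rho F br.

Lemma bracket_addl e1 e2 e x : section F e1 -> section F e2 -> section F e ->
  br (fun y => e1 y + e2 y) e x = br e1 e x + br e2 e x.
Proof.
move=> h1 h2 h; rewrite -[br e1 e x]scale1r -(br_linear hbr 1 h1 h2 h).
by congr (br _ e x); apply: functional_extensionality_dep => y; rewrite scale1r.
Qed.

Lemma bracket_zerol e x : section F e -> br (fun=> 0) e x = 0.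
Proof.
move=> h; have := bracket_addl x (section0 sF) (section0 sF) h.
rewrite (_ : (fun y => 0 + 0) = fun y => 0 : E y); last first.
  by apply: functional_extensionality_dep => y; rewrite addr0.
by move/self_double_eq0.
Qed.

Lemma bracket_linr a e1 e2 e x : section F e1 -> section F e2 -> section F e ->
  br e (fun y => a *: e1 y + e2 y) x = a *: br e e1 x + br e e2 x.
Proof.
move=> h1 h2 h; have h12 : section F (fun y => a *: e1 y + e2 y).
  by apply: sectionD => //; exact: sectionZc.
rewrite (br_skew hbr)// (br_linear hbr)// opprD -scalerN.
by rewrite -!(br_skew hbr).
Qed.

Lemma bracket_oppl e1 e x : section F e1 -> section F e ->
  br (fun y => - e1 y) e x = - br e1 e x.
Proof.
move=> h1 h; have := br_linear hbr (-1) h1 (section0 sF) h x.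
rewrite (bracket_zerol x h) addr0 scaleN1r => <-; congr (br _ e x).
by apply: functional_extensionality_dep => y; rewrite scaleN1r addr0.
Qed.

End Brackets.

(** * The geometry of a splitting *)

Section Splitting.
Context {R : realType} {M : manifold R} {E : vector_bundle M}.
Context {g : metric E} {rho : anchor E} {Q C : subfamily E}.
Arguments Q : clear implicits.
Arguments C : clear implicits.
Implicit Types (s t : forall x, E x) (x y : M).

Hypothesis hE : courant_vector_bundle g rho (full E).
Hypothesis surj : surjective_anchor rho.
Hypothesis hs : splitting g rho Q C.

Notation P := (extension g rho Q).
Notation dd := (partial g rho (full E)).
Let sE : subbundle (full E). Proof. by have [[]] := hE. Qed.
Let nondeg x u : (forall v, g x u v = 0) -> u = 0.
Proof. by move=> gu; have [[_ nd] _ _] := hE; apply: nd. Qed.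
Let isot : isotropic g (partial_im g rho (full E)).
Proof. by have [] := hE. Qed.
Let sC : subbundle C := split_C hs.
Let sQ : subbundle Q := split_Q hs.

Lemma partial_im0 x : partial_im g rho (full E) x 0.
Proof. by have [/seteqP[_ /(_ 0 erefl)[]]] := split_C_complement hs x. Qed.

Lemma partial_im_sub x u : partial_im g rho (full E) x u -> P x u.
Proof.
by move=> du; exists u => //; exists 0; [exact: subbundle0|rewrite addr0].
Qed.

Lemma Q_sub x u : Q x u -> P x u.
Proof.
by move=> Qu; exists 0; [exact: partial_im0|exists u => //; rewrite add0r].
Qed.

Lemma anchor_C x c : C x c -> rho x c = 0.
Proof.
move=> Cc; have [_ /seteqP[+ _]] := split_C_complement hs x; apply.
by exists c => //; exists 0; [exact: partial_im0|rewrite addr0].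
Qed.

Lemma metric_PC x p c : P x p -> C x c -> g x p c = 0.
Proof. by have := split_orthogonal hs; apply. Qed.

Lemma metric_CP x p c : P x p -> C x c -> g x c p = 0.
Proof. by rewrite Defs.metric_sym; exact: metric_PC. Qed.

Lemma splitPC x e : exists2 c, C x c & P x (e - c).
Proof.
have [_ /seteqP[_ /(_ e I)[p Pp [c Cc <-]]]] := split_sum hs x.
by exists c => //; rewrite addrK.
Qed.

Lemma C_nondeg x c : C x c -> (forall c', C x c' -> g x c c' = 0) -> c = 0.
Proof.
move=> Cc Hc; apply: nondeg => e; have [c' Cc' Pe] := splitPC e.
by rewrite -(subrK c' e) gDr (Hc c')// addr0 metric_CP.
Qed.

Lemma P_nondeg x p : P x p -> (forall q, P x q -> g x p q = 0) -> p = 0.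
Proof.
move=> Pp Hp; apply: nondeg => e; have [c' Cc' Pe] := splitPC e.
by rewrite -(subrK c' e) gDr Hp// add0r metric_PC.
Qed.

Lemma P_orthP x u : P x u <-> forall c, C x c -> g x u c = 0.
Proof.
split=> [Pu c|H]; first exact: metric_PC.
have [c Cc Pu] := splitPC u; suff c0 : c = 0 by move: Pu; rewrite c0 subr0.
apply: C_nondeg => // c' Cc'; have := metric_PC Pu Cc'.
by rewrite gBl H// sub0r => /eqP; rewrite oppr_eq0 => /eqP.
Qed.

Lemma C_orthP x u : C x u <-> forall p, P x p -> g x u p = 0.
Proof.
split=> [Cu p Pp|H]; first exact: metric_CP.
have [c Cc Pu] := splitPC u; suff : u - c = 0 by move/subr0_eq => ->.
apply: P_nondeg => // p Pp; rewrite gBl H// sub0r metric_CP ?oppr0//.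
Qed.

Lemma P_lin x (a : R) u v : P x u -> P x v -> P x (a *: u + v).
Proof.
move=> /P_orthP Pu /P_orthP Pv; apply/P_orthP => c Cc.
by rewrite gDl gZl Pu// Pv// mulr0 addr0.
Qed.

Lemma P0 x : P x 0.
Proof. by apply: Q_sub; exact: subbundle0. Qed.

Definition projC x (e : E x) : E x := xget 0 [set c | C x c /\ P x (e - c)].

Lemma projC_spec x e : C x (projC e) /\ P x (e - projC e).
Proof.
rewrite /projC; case: xgetP => [c _ //|H].
by have [c Cc Pe] := splitPC e; case: (H c).
Qed.

Lemma projC_in x e : C x (projC e). Proof. by case: (projC_spec e). Qed.

Lemma projC_P x e : P x (e - projC e). Proof. by case: (projC_spec e). Qed.

Lemma projC_uniq x e c : C x c -> P x (e - c) -> projC e = c.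
Proof.
move=> Cc Pe; apply/eqP; rewrite -subr_eq0; apply/eqP; apply: C_nondeg.
  by apply: subbundleB => //; exact: projC_in.
have -> : projC e - c = (e - c) - (e - projC e).
  by rewrite opprB [RHS]addrC addrA subrK.
by move=> c' Cc'; rewrite gBl !metric_PC ?subrr//; exact: projC_P.
Qed.

Lemma projC_eq0 x p : P x p -> projC p = 0.
Proof. by move=> Pp; apply: projC_uniq; rewrite ?subr0//; exact: subbundle0. Qed.

Lemma projC_lin x (a : R) (u v : E x) : projC (a *: u + v) = a *: projC u + projC v.
Proof.
apply: projC_uniq; first by apply: subbundleP => //; exact: projC_in.
rewrite opprD addrACA -scalerBr.
by apply: P_lin; exact: projC_P.
Qed.

Lemma metric_projC x e c : C x c -> g x (projC e) c = g x e c.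
Proof.
by move=> Cc; rewrite -{2}(subrK (projC e) e) gDl (metric_PC (projC_P e)) ?add0r.
Qed.

(** Against sections of [C], the projection of [s] has the same products as [s]. *)
Lemma smooth_projC s : (forall x, smooth_section_at x s) ->
  forall x, smooth_section_at x (fun y => projC (s y)).
Proof.
move=> ss; apply: (@smooth_of_covectors _ _ _ C {t | section C t}
  (fun i y u => g y u (sval i y)) (fun y => projC (s y))) => //.
- by move=> x; exact: projC_in.
- by move=> [t sct]; apply: metric_covector; apply/smooth_sectionP; case: sct.
- move=> x w Cw Hw; apply: C_nondeg => // c Cc.
  by have [t [sct <-]] := extend_to_section sC Cc; exact: (Hw (exist _ t sct)).
- move=> [t sct] x /=; have [/smooth_sectionP st Ct] := sct.
  rewrite (_ : (fun y => _) = fun y => g y (s y) (t y)); last first.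
    by apply/funext => y; rewrite metric_projC.
  exact: smooth_metric.
Qed.

Lemma section_projC s : section (full E) s -> section C (fun y => projC (s y)).
Proof.
move=> [/smooth_sectionP ss _]; split; last by move=> x; exact: projC_in.
by apply/smooth_sectionP => x; exact: smooth_projC.
Qed.

Lemma section_projP s : section (full E) s ->
  section P (fun y => s y - projC (s y)).
Proof.
move=> sfs; have [/smooth_sectionP ss _] := sfs; split.
  apply/smooth_sectionP => x; apply: smooth_section_atB => //.
  exact: smooth_projC.
by move=> x; exact: projC_P.
Qed.

(** A basis of one fiber of [P] is extended to global sections of [E], which are
    projected to [P]; they stay independent nearby, and they span [P] because the
    rank of [P], complementary to that of [C], is locally constant. *)
Lemma subbundle_P : subbundle P.
Proof.
move=> x; have [VP PE] := vspace_of_closed (P0 x) (@P_lin x).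
pose k := \dim VP; pose X := vbasis VP.
have /choice[S HS] : forall i : 'I_k, exists s, section P s /\ s x = X`_i.
  move=> i; have [s [sfs sx]] := extend_to_section sE (I : full E x X`_i).
  exists (fun y => s y - projC (s y)); split; first exact: section_projP.
  rewrite sx projC_eq0 ?subr0// PE /=; apply: vbasis_mem.
  by rewrite mem_nth// size_tuple.
pose t y := [tuple S i y | i < k].
have tE y i : tnth (t y) i = S i y by rewrite tnth_mktuple.
have st i y : smooth_section_at y (fun z => tnth (t z) i).
  have [[/smooth_sectionP ss _] _] := HS i.
  by apply: (near_section_eq (P := fun=> True) _ _ (ss y)) => [|z _];
    [exact: filterT|rewrite tE].
have tx : free (t x).
  rewrite (_ : tval (t x) = X); first exact: (basis_free (vbasisP VP)).
  apply: (@eq_from_nth _ 0); rewrite !size_tuple// => i ik.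
  rewrite -[i]/(val (Ordinal ik)) -tnth_nth tE.
  by have [_ ->] := HS (Ordinal ik).
have nt := free_near (fun a => st a x) tx.
have [i ix] := frame_cover E x.
have [U [m [c [oU Ux sc cC]]]] := sC x.
have dimP y : U y -> frame_dom E i y -> forall W : {vspace E y},
    P y = [set` W] -> (\dim W + m)%N = frame_rank E i.
  move=> Uy iy W PW; have [fc CE] := cC _ Uy.
  have cap0 : (W :&: <<c y>>)%VS = 0%VS.
    apply/eqP; rewrite -subv0; apply/subvP => u /memv_capP[uW uc].
    rewrite memv0; apply/eqP; apply: (@P_nondeg y).
      by rewrite PW.
    by move=> q Pq; apply: metric_CP => //; rewrite CE.
  have addT : (W + <<c y>>)%VS = fullv.
    apply/eqP; rewrite eqEsubv subvf /=; apply/subvP => u _.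
    have [c' Cc' Pu] := splitPC u; rewrite -(subrK c' u) memv_add//.
      by move: Pu; rewrite PW.
    by move: Cc'; rewrite CE.
  have := dimv_sum_cap W <<c y>>%VS; rewrite cap0 addT dimv0 addn0.
  have /eqP -> := fc; rewrite size_tuple => <-.
  have /andP[/eqP <- /eqP ->] := frame_basis iy.
  by rewrite size_tuple.
have [B [[oB Bx] HB]] : exists B, open_nbhs x B /\
    forall y, B y -> [/\ free (t y), U y & frame_dom E i y].
  have : nbhs x [set y | [/\ free (t y), U y & frame_dom E i y]].
    have nU : nbhs x U by apply: open_nbhs_nbhs; split.
    apply: filterS (filterI nt (filterI nU (frame_dom_nbhs ix))) => y /=.
    by case=> ? [].
  by rewrite nbhsE => -[B oB BH]; exists B.
exists B, k, t; split=> //.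
  by move=> a; apply/smooth_section_onP => // y By; exact: st.
move=> y By; have [fty Uy iy] := HB _ By; split=> //.
have [W PW] := vspace_of_closed (P0 y) (@P_lin y).
rewrite PW; suff -> : W = <<t y>>%VS by [].
apply/eqP; rewrite eq_sym eqEdim; apply/andP; split.
  apply/span_subvP => u /tnthP[a ->]; rewrite tE.
  have [[_ Py] _] := HS a; have := Py y; by rewrite PW.
have /eqP -> := fty; rewrite size_tuple -(leq_add2r m) (dimP y Uy iy W PW).
by rewrite -(dimP x Ux ix VP PE).
Qed.

Lemma P_pseudo_euclidean : pseudo_euclidean g P.
Proof. split; [exact: subbundle_P|by move=> x u; exact: P_nondeg]. Qed.

Lemma C_pseudo_euclidean : pseudo_euclidean g C.
Proof. by split; [exact: sC|move=> x u; exact: C_nondeg]. Qed.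

(** The 1-form vanishes on the anchors of [C], so that the vector which represents
    it in [E] is orthogonal to [C], and hence lies in [P]. *)
Lemma partial_P x (alpha : tangent x -> R) :
  (forall a u v, alpha (a *: u + v) = a * alpha u + alpha v) ->
  partial g rho P alpha = dd alpha.
Proof.
move=> lin; congr (_ *: _).
have linr a u v : alpha (rho x (a *: u + v)) =
    a * alpha (rho x u) + alpha (rho x v).
  by rewrite linearP lin.
have full_sharp := sharp_fullP nondeg linr.
set w := sharp g (full E) _ in full_sharp *.
have Pw : P x w.
  apply/P_orthP => c Cc; rewrite full_sharp anchor_C//.
  by have := lin (-1) 0 0; rewrite scaler0 addr0 mulN1r addNr.
rewrite {1}/sharp; case: xgetP => [v _ /= [Pv Hv]|]; last first.
  by move/(_ w) => []; split=> // e _; exact: full_sharp.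
apply/eqP; rewrite -subr_eq0; apply/eqP; apply: (@P_nondeg x).
  by rewrite -scaleN1r addrC; apply: P_lin.
by move=> q Pq; rewrite gBl Hv// full_sharp subrr.
Qed.

Lemma partial_fun_P f : partial_fun g rho P f = partial_fun g rho (full E) f.
Proof. by apply: functional_extensionality_dep => x; exact: partial_P. Qed.

Lemma partial_im_P x u : partial_im g rho P x u -> partial_im g rho (full E) x u.
Proof.
by move=> [alpha ->]; exists alpha; apply: partial_P => a v w; rewrite linearP.
Qed.

Lemma anchor_P_im x : rho x @` P x = rho x @` full E x.
Proof.
apply/seteqP; split=> [_ [u _ <-]|_ [u _ <-]]; first by exists u.
have [c Cc Pu] := splitPC u; exists (u - c) => //.
by rewrite linearB /= (anchor_C Cc) subr0.
Qed.

Lemma P_courant_vector_bundle : courant_vector_bundle g rho P.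
Proof.
have [_ fol _] := hE; split; first exact: P_pseudo_euclidean.
  rewrite (_ : (fun x => _) = fun x => rho x @` full E x)//.
  by apply: functional_extensionality_dep => x; exact: anchor_P_im.
by move=> x u v /partial_im_P du /partial_im_P dv; exact: (isot du dv).
Qed.

Lemma Q_ker0 x q : Q x q -> rho x q = 0 -> q = 0.
Proof.
move=> Qq rq; have [/seteqP[+ _] _] := split_Q_complement hs x.
by apply; split.
Qed.

Lemma P_neutral : neutral g P.
Proof.
move=> x; have [A0 Alin] : partial_im g rho (full E) x 0 /\ forall (a : R) u v,
    partial_im g rho (full E) x u -> partial_im g rho (full E) x v ->
    partial_im g rho (full E) x (a *: u + v).
  split=> [|a u v]; first exact: partial_im0.
  rewrite !(partial_im_orthP nondeg surj) => Hu Hv e re.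
  by rewrite gDl gZl Hu// Hv// mulr0 addr0.
apply: neutral_of_isotropic => //.
- by move=> u v; exact: Defs.metric_sym.
- exact: subbundle0.
- by move=> a u v; exact: subbundleP.
- by move=> u v; exact: isot.
- by move=> u v; exact: (split_Q_isotropic hs).
- move=> u du uQ; apply: P_nondeg; first exact: partial_im_sub.
  move=> _ [v dv [q Qq <-]]; rewrite gDr (uQ q Qq) addr0; exact: (isot du dv).
- move=> q Qq uQ; apply: P_nondeg; first exact: Q_sub.
  move=> _ [v dv [q' Qq' <-]]; rewrite gDr Defs.metric_sym (uQ v dv) add0r.
  exact: (split_Q_isotropic hs Qq Qq').
Qed.

Definition liftQ x (v : tangent x) : E x := xget 0 [set q | Q x q /\ rho x q = v].

Lemma liftQ_spec x v : Q x (liftQ v) /\ rho x (liftQ v) = v.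
Proof.
rewrite /liftQ; case: xgetP => [q _ //|H].
have [e re] := surj v.
have [_ /seteqP[_ /(_ e I)[q Qq [k rk qk]]]] := split_Q_complement hs x.
by case: (H q); split=> //; rewrite -re -qk linearD /= rk addr0.
Qed.

Lemma liftQ_in x v : Q x (liftQ v). Proof. by case: (liftQ_spec v). Qed.

Lemma liftQK x v : rho x (liftQ v) = v. Proof. by case: (liftQ_spec v). Qed.

Lemma liftQ_uniq x q : Q x q -> liftQ (rho x q) = q.
Proof.
move=> Qq; apply/eqP; rewrite -subr_eq0; apply/eqP; apply: Q_ker0.
  by apply: subbundleB => //; exact: liftQ_in.
by rewrite linearB /= liftQK subrr.
Qed.

Lemma liftQ_lin x (a : R) (v w : tangent x) :
  liftQ (a *: v + w) = a *: liftQ v + liftQ w.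
Proof.
rewrite -{1}(liftQK v) -{1}(liftQK w) -linearP liftQ_uniq//.
by apply: subbundleP => //; exact: liftQ_in.
Qed.

(** Evaluation of anchors on smooth functions gives covectors that separate the
    fibers of [Q]. *)
Lemma section_liftQ X : vector_field X -> section Q (fun x => liftQ (X x)).
Proof.
move=> vX; split; last by move=> x; exact: liftQ_in.
apply/smooth_sectionP; apply: (@smooth_of_covectors _ _ _ Q {f : M -> R | smooth f}
  (fun f y u => rho y u (sval f)) (fun x => liftQ (X x))) => //.
- by move=> x; exact: liftQ_in.
- by case=> f sf; exact: anchor_covector.
- move=> x w Qw Hw; apply: Q_ker0 => //; apply: tangent_ext => f sf.
  exact: (Hw (exist _ f sf)).
- move=> [f sf] x /=; rewrite (_ : (fun y => _) = fun y => X y f).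
    by move/smoothP: (vX f sf); apply.
  by apply/funext => y; rewrite liftQK.
Qed.

Lemma section_P_of_Q s : section Q s -> section P s.
Proof. by case=> ss Qs; split=> // x; exact: Q_sub. Qed.

(** * From a bracket to a flat connection *)

Lemma partial_fun_zero (f : M -> R) x : (forall y, f y = 0) ->
  partial_fun g rho (full E) f x = 0.
Proof.
move=> f0; apply: nondeg => v; rewrite partial_funE//.
rewrite (_ : f = fun=> 0); last by apply/funext.
by rewrite tangent_zero mulr0.
Qed.

Lemma P_ker_im x u : P x u -> rho x u = 0 -> partial_im g rho (full E) x u.
Proof.
move=> [d dd' [q Qq <-]]; rewrite linearD /= (anchor_partial_im nondeg isot dd').
by rewrite add0r => /(Q_ker0 Qq) ->; rewrite addr0.
Qed.

Lemma lie_bracket_zero (X Y : forall x : M, tangent x) x :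
  (forall y, X y = 0) -> (forall y, Y y = 0) -> lie_bracket X Y x = 0.
Proof.
move=> X0 Y0; rewrite /lie_bracket.
rewrite (_ : (fun f => _) = val (0 : tangent x)) ?valKd//.
by apply/funext => f; rewrite X0 Y0 /= subrr.
Qed.

Section BracketToConnection.
Variable br : (forall x, E x) -> (forall x, E x) -> forall x, E x.
Hypothesis hbr : courant_bracket g rho (full E) br.
Hypothesis hcl : forall e1 e2, section P e1 -> section P e2 -> section P (br e1 e2).

(** The metric axiom moves the bracket from [s] to a section of [P], where it stays
    in [P]; so the bracket of [e] and [s] is orthogonal to [P]. *)
Lemma bracket_PC_in_C e s : section P e -> section C s -> section C (br e s).
Proof.
move=> he hs'; have [+ _] := br_section hbr (section_full he) (section_full hs').
split=> // x; apply/C_orthP => p Pp.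
have [q [hq <-]] := extend_to_section subbundle_P Pp.
have := br_metric hbr (section_full he) (section_full hs') (section_full hq) x.
have [Pe Cs Pq] := And3 he.2 hs'.2 hq.2.
rewrite (_ : (fun y => g y (s y) (q y)) = fun=> 0); last first.
  by apply/funext => y; exact: metric_CP.
rewrite tangent_zero [partial_fun _ _ _ _ x]partial_fun_zero ?addr0; last first.
  by move=> y; exact: metric_PC.
have [_ Peq] := hcl he hq.
rewrite gDr (metric_CP (Peq x) (Cs x)) (metric_CP _ (Cs x)) ?addr0 => [->//|].
by apply: partial_im_sub; exact: partial_fun_im.
Qed.

(** Tested against a section [t] of [C]: the metric axiom turns [g([s, e], t)] into
    [g([s, t], e)], which vanishes because the anchor kills [[s, t]] and [e] is
    orthogonal to the kernel of the anchor. *)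
Lemma bracket_imC_eq0 e s x : section (full E) e ->
  (forall y, partial_im g rho (full E) y (e y)) -> section C s -> br e s x = 0.
Proof.
move=> he de hs'.
have hPe : section P e by case: he => se _; split=> // y; exact: partial_im_sub.
have [_ Cb] := bracket_PC_in_C hPe hs'.
apply: C_nondeg => // c Cc; have [t [ht <-]] := extend_to_section sC Cc.
have [[_ Cs] [_ Ct]] := (hs', ht).
have := br_metric hbr (section_full hs') (section_full ht) he x.
rewrite anchor_C// [X in X = _](_ : _ = 0)//.
rewrite [X in g x _ (_ + X)]partial_fun_zero; last first.
  by move=> y; apply: metric_CP => //; exact: partial_im_sub.
rewrite addr0 gDl (isot (partial_fun_im _ _ _ _)) // addr0.
rewrite [X in X + _]Defs.metric_sym (partial_im_ker nondeg (de x)) ?add0r.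
  rewrite (br_skew hbr (section_full hs') he) gNr Defs.metric_sym => /esym/eqP.
  by rewrite oppr_eq0 => /eqP.
rewrite (br_anchor hbr (section_full hs') (section_full ht)).
by apply: lie_bracket_zero => y; exact: anchor_C.
Qed.

Lemma bracket_Plin_C (f : M -> R) e1 e2 s x : smooth f -> section P e1 ->
  section P e2 -> section C s ->
  br (fun y => f y *: e1 y + e2 y) s x = f x *: br e1 s x + br e2 s x.
Proof.
move=> sf h1 h2 hs'; have [[_ P1] [_ Cs]] := (h1, hs').
have [f1 f2 fs] := And3 (section_full h1) (section_full h2) (section_full hs').
have hz := sectionZ sE sf f1.
rewrite (bracket_addl hbr)//; congr (_ + _).
rewrite (br_skew hbr)// (br_leibniz hbr)// anchor_C// metric_CP//.
by rewrite [X in X *: e1 x](_ : _ = 0)// !scale0r addr0 subr0 -scalerN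
  -(br_skew hbr).
Qed.

(** Flatness is the Jacobi identity for two lifts [a], [b] to [Q] and a section of
    [C]: its right-hand side vanishes by orthogonality of [P] and [C], and
    [[a, b]] differs from the lift of the Lie bracket by a section of the image of
    the coboundary, whose bracket with sections of [C] is 0. *)
Lemma bracket_connection : flat_metric_connection g C
  (fun X s => br (fun x => liftQ (X x)) s).
Proof.
have hQ X : vector_field X -> section P (fun x => liftQ (X x)).
  by move=> /section_liftQ; exact: section_P_of_Q.
split.
- by move=> X s /hQ hX; exact: bracket_PC_in_C.
- move=> f X Y s sf /hQ hX /hQ hY hs' x.
  rewrite (_ : (fun y => liftQ (f y *: X y + Y y)) =
      fun y => f y *: liftQ (X y) + liftQ (Y y)).
    exact: bracket_Plin_C.
  by apply: functional_extensionality_dep => y; exact: liftQ_lin.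
- move=> a X s t /hQ hX hs' ht x.
  have [fs ft fX] := And3 (section_full hs') (section_full ht) (section_full hX).
  exact: (bracket_linr sE hbr a x fs ft fX).
- move=> f X s sf /hQ hX hs' x.
  rewrite (br_leibniz hbr (section_full hX) (section_full hs') sf) liftQK.
  have [[_ PX] [_ Cs]] := (hX, hs').
  by rewrite metric_PC// scale0r subr0 addrC.
- move=> X s t /hQ hX hs' ht x.
  have := br_metric hbr (section_full hX) (section_full hs') (section_full ht) x.
  have [PX Cs Ct] := And3 hX.2 hs'.2 ht.2.
  by rewrite liftQK !partial_fun_zero ?addr0// => y; exact: metric_PC.
- move=> X Y s vX vY hs' x.
  have [hX hY] := (hQ _ vX, hQ _ vY).
  set a := fun x => liftQ (X x); set b := fun x => liftQ (Y x).
  have [fa fb fs] := And3 (section_full hX) (section_full hY) (section_full hs').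
  have hab := br_section hbr fa fb.
  have lieE : lie_bracket X Y = fun y => rho y (br a b y).
    apply: functional_extensionality_dep => y; rewrite (br_anchor hbr)//.
    by congr (lie_bracket _ _ y); apply: functional_extensionality_dep => z;
      rewrite /a /b liftQK.
  have hlie : section P (fun y => liftQ (lie_bracket X Y y)).
    by apply: hQ; rewrite lieE; exact: anchor_vector_field hab.
  have hbs := bracket_PC_in_C hY hs'; have has := bracket_PC_in_C hX hs'.
  have [Pa Pb Cs] := And3 hX.2 hY.2 hs'.2.
  have [Cbs Cas Pab] := And3 hbs.2 has.2 (hcl hX hY).2.
  have hsa : br s a = fun y => - br a s y.
    by apply: functional_extensionality_dep => y; rewrite (br_skew hbr).
  have := br_jacobi hbr fa fb fs x.
  rewrite partial_fun_zero; last first.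
    by move=> y; rewrite hsa gNl (metric_PC (Pab y) (Cs y)) (metric_CP (Pa y) (Cbs y))
      (metric_CP (Pb y) (Cas y)) oppr0 !addr0.
  rewrite scaler0 hsa (br_skew hbr (section_full hbs) fa).
  rewrite (bracket_oppl sE hbr)//; last exact: section_full has.
  rewrite (br_skew hbr (section_full has) fb) opprK => jac.
  suff E1 : br (fun y => liftQ (lie_bracket X Y y)) s x = br (br a b) s x.
    have flip (u v w : E x) : u - v + w = 0 -> v - w - u = 0.
      by move=> uvw; rewrite -oppr0 -uvw !opprD opprK addrAC [- u + v]addrC.
    by rewrite E1; exact: flip.
  apply/eqP; rewrite eq_sym -subr_eq0; apply/eqP.
  rewrite -(bracket_oppl sE hbr x (section_full hlie) fs).
  rewrite -(bracket_addl hbr)//; last exact: (sectionN sE (section_full hlie)).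
  apply: bracket_imC_eq0 => //; first exact: (sectionB sE hab (section_full hlie)).
  move=> y; apply: P_ker_im; last by rewrite linearB /= liftQK lieE subrr.
  have [_ Plie] := hlie.
  rewrite addrC -scaleN1r; apply: P_lin => //; exact: Plie.
Qed.

Lemma bracket_restrict : courant_bracket g rho P br.
Proof.
split.
- exact: hcl.
- move=> a e1 e2 e /section_full h1 /section_full h2 /section_full h.
  exact: (br_linear hbr).
- by move=> e1 e2 /section_full h1 /section_full h2; exact: (br_skew hbr).
- by move=> e1 e2 /section_full h1 /section_full h2; exact: (br_anchor hbr).
- move=> x alpha; rewrite partial_P => [|a v w]; last by rewrite linearP.
  exact: (br_anchor_partial hbr).
- move=> e1 e2 e3 /section_full h1 /section_full h2 /section_full h3 x.
  by rewrite partial_fun_P (br_jacobi hbr).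
- move=> e1 e2 f /section_full h1 /section_full h2 sf x.
  by rewrite partial_fun_P (br_leibniz hbr).
- move=> e e1 e2 /section_full h /section_full h1 /section_full h2 x.
  by rewrite !partial_fun_P (br_metric hbr).
Qed.

End BracketToConnection.

(** * From a flat connection to a bracket *)

Section ConnectionToBracket.
Variable B : (forall x, E x) -> (forall x, E x) -> forall x, E x.
Hypothesis hB : courant_bracket g rho P B.
Variable nabla : (forall x : M, tangent x) -> (forall x, E x) -> forall x, E x.
Hypothesis hn : flat_metric_connection g C nabla.

Let sP : subbundle P := subbundle_P.

Lemma vector_field_lin (f : M -> R) (X Y : forall x : M, tangent x) : smooth f ->
  vector_field X -> vector_field Y -> vector_field (fun y => f y *: X y + Y y).
Proof.
move=> /smoothP sf vX vY h sh; apply/smoothP => x.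
have [/smoothP sX /smoothP sY] := (vX h sh, vY h sh).
exact: (smooth_atD (smooth_atM (sf x) (sX x)) (sY x)).
Qed.

Lemma vector_field0 : vector_field (fun x : M => 0 : tangent x).
Proof. by move=> h sh; exact: smooth_cst. Qed.

Lemma nabla0l s x : section C s -> nabla (fun=> 0) s x = 0.
Proof.
move=> hs'.
have := nabla_linear_l hn (smooth_cst 1) vector_field0 vector_field0 hs' x.
rewrite (_ : (fun y => 1 *: 0 + 0) = fun y : M => 0 : tangent y); last first.
  by apply: functional_extensionality_dep => y; rewrite scaler0 addr0.
by rewrite scale1r; exact: self_double_eq0.
Qed.

Lemma nabla_sum k (f : 'I_k -> M -> R) (X : 'I_k -> forall x : M, tangent x) s x :
  (forall a, smooth (f a)) -> (forall a, vector_field (X a)) -> section C s ->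
  vector_field (fun y => \sum_a f a y *: X a y) /\
  nabla (fun y => \sum_a f a y *: X a y) s x = \sum_a f a x *: nabla (X a) s x.
Proof.
move=> sf vX hs'; elim: (index_enum _) => [|a r [vr IH]].
  rewrite (_ : (fun y => _) = fun y : M => 0 : tangent y); last first.
    by apply: functional_extensionality_dep => y; rewrite big_nil.
  by rewrite big_nil nabla0l//; split=> //; exact: vector_field0.
rewrite (_ : (fun y => _) = fun y =>
    f a y *: X a y + \sum_(b <- r) f b y *: X b y).
  by rewrite big_cons (nabla_linear_l hn)// IH; split=> //; exact: vector_field_lin.
by apply: functional_extensionality_dep => y; rewrite big_cons.
Qed.

(** After multiplication by the square of a bump function, a lift of [X] is a
    combination of global sections with global coefficients: one factor extends
    the vectors of a local frame, the other one the coordinates of the lift, which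
    vanish at [x]. *)
Lemma nabla_eq0 X s x : vector_field X -> section C s -> X x = 0 ->
  nabla X s x = 0.
Proof.
move=> vX hs' Xx0; pose e y := liftQ (X y).
have he : section (full E) e by exact: section_full (section_liftQ vX).
have ex0 : e x = 0.
  by rewrite /e Xx0 -[0 in LHS](linear0 (rho x)) liftQ_uniq//; exact: subbundle0.
have [i ix] := frame_cover E x.
have [phi [K [sphi phix cK KU phi0]]] := bump_function (frame_dom_open i) ix.
pose f a y := phi y * coord (frame E i y) a (e y).
pose t a y := phi y *: tnth (frame E i y) a.
have sf a : smooth (f a).
  apply: cutoff_function cK KU sphi phi0 _; first exact: frame_dom_open.
  by move=> y iy; have [/smooth_sectionP se _] := he; exact: se.
have st a : section (full E) (t a).
  split=> //; apply/smooth_sectionP.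
  apply: cutoff_section cK KU sphi phi0 _; first exact: frame_dom_open.
  by move=> y iy; exact: smooth_frame.
have [_ nS] := nabla_sum x sf (fun a => anchor_vector_field rho (st a)) hs'.
have sphi2 : smooth (fun y => phi y * phi y) by exact: smoothM.
have := nabla_linear_l hn sphi2 vX vector_field0 hs' x.
rewrite nabla0l// addr0 phix mul1r scale1r => <-.
rewrite (_ : (fun y => _) = fun y => \sum_a f a y *: rho y (t a y)).
  by rewrite nS big1// => a _; rewrite /f ex0 linear0 mulr0 scale0r.
apply: functional_extensionality_dep => y; rewrite addr0.
have [Ky|Ky] := pselect (K y); last first.
  by rewrite phi0// mul0r scale0r big1// => a _; rewrite /f phi0// mul0r scale0r.
rewrite -[X y](liftQK (X y)) -/(e y) {1}(coord_frame (e y) (KU _ Ky)).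
rewrite linear_sum scaler_sumr; apply: eq_bigr => a _.
by rewrite /f /t !linearZ /= !scalerA; congr (_ *: _); ring.
Qed.

Lemma nabla_pointwise X Y s x : vector_field X -> vector_field Y -> section C s ->
  X x = Y x -> nabla X s x = nabla Y s x.
Proof.
move=> vX vY hs' XY.
have vZ := vector_field_lin (smooth_cst (-1)) vY vX.
have := nabla_eq0 (x := x) vZ hs'; rewrite XY scaleN1r addNr => /(_ erefl).
rewrite (nabla_linear_l hn (smooth_cst (-1)) vY vX hs') scaleN1r addrC.
by move=> /subr0_eq ->.
Qed.

Lemma extend_vector_field x (v : tangent x) : exists X : forall x, tangent x,
  vector_field X /\ X x = v.
Proof.
have [e <-] := surj v.
have [s [hs' <-]] := extend_to_section sE (I : full E x e).
by exists (fun y => rho y (s y)); split=> //; exact: anchor_vector_field hs'.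
Qed.

(** If a bracket restricts to the connection on pairs from [P] and [C], then for
    sections [s], [t] of [C] and [p] of [P] compatibility with the metric forces
    [g([s, t], p) = (g(nabla_p s, t) - g(s, nabla_p t)) / 2], that is, the
    [P]-component of [[s, t]] is the coboundary of [v |-> g(nabla_v s, t) -
    g(s, nabla_v t)]. *)
Definition omega s t x (v : tangent x) : R :=
  let X := sval (cid (extend_vector_field v)) in
  g x (nabla X s x) (t x) - g x (s x) (nabla X t x).

Definition beta s t x : E x := dd (omega s t (x := x)).

Lemma omegaE s t X x : section C s -> section C t -> vector_field X ->
  omega s t (X x) = g x (nabla X s x) (t x) - g x (s x) (nabla X t x).
Proof.
move=> hs' ht vX; rewrite /omega; case: cid => Y /= [vY YX].
by rewrite !(nabla_pointwise vY vX _ YX).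
Qed.

Lemma omega_lin s t x (a : R) (u v : tangent x) : section C s -> section C t ->
  omega s t (a *: u + v) = a * omega s t u + omega s t v.
Proof.
move=> hs' ht; have [X [vX <-]] := extend_vector_field u.
have [Y [vY <-]] := extend_vector_field v.
rewrite (omegaE _ hs' ht (vector_field_lin (smooth_cst a) vX vY)) !omegaE//.
rewrite !(nabla_linear_l hn (smooth_cst a) vX vY)// gDl gZl gDr gZr; ring.
Qed.

Lemma betaE s t x e : section C s -> section C t ->
  g x (beta s t x) e = 2^-1 * omega s t (rho x e).
Proof.
by move=> hs' ht; rewrite partialE// => a u v; exact: omega_lin.
Qed.

Notation vf e := (fun y => rho y (e y)).

Lemma beta_sectionE s t e x : section C s -> section C t -> section (full E) e ->
  g x (beta s t x) (e x) =
  2^-1 * (g x (nabla (vf e) s x) (t x) - g x (s x) (nabla (vf e) t x)).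
Proof.
move=> hs' ht he; rewrite betaE//.
by rewrite (omegaE x hs' ht (anchor_vector_field rho he)).
Qed.

Lemma beta_im s t x : section C s -> section C t ->
  partial_im g rho (full E) x (beta s t x).
Proof.
move=> hs' ht; apply/partial_imP; exists (@omega s t x) => // a v w.
exact: omega_lin.
Qed.

Lemma section_beta s t : section C s -> section C t -> section P (beta s t).
Proof.
move=> hs' ht; split; last by move=> x; apply: partial_im_sub; exact: beta_im.
apply/smooth_sectionP; apply: (@smooth_of_covectors _ _ _ (full E)
  {e | section (full E) e} (fun i y u => g y u (sval i y)) (beta s t)) => //.
- by move=> [e he]; apply: metric_covector; apply/smooth_sectionP; case: he.
- move=> x w _ Hw; apply: nondeg => v.
  have [e [he <-]] := extend_to_section sE (I : full E x v).
  exact: (Hw (exist _ e he)).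
- move=> [e he] x /=.
  rewrite (_ : (fun y => _) = fun y => 2^-1 *
    (g y (nabla (vf e) s y) (t y) - g y (s y) (nabla (vf e) t y))); last first.
    by apply/funext => y; rewrite beta_sectionE.
  have [h1 h2] := (nabla_section hn (anchor_vector_field rho he) hs',
    nabla_section hn (anchor_vector_field rho he) ht).
  have [/smooth_sectionP s1 _] := h1. have [/smooth_sectionP s2 _] := h2.
  have [/smooth_sectionP s3 _] := hs'. have [/smooth_sectionP s4 _] := ht.
  apply: smooth_atM; first exact: smooth_at_cst.
  by apply: smooth_atB; exact: smooth_metric.
Qed.

Lemma beta_linl s1 s2 t x (a : R) : section C s1 -> section C s2 -> section C t ->
  beta (fun y => a *: s1 y + s2 y) t x = a *: beta s1 t x + beta s2 t x.
Proof.
move=> h1 h2 ht; have h12 : section C (fun y => a *: s1 y + s2 y).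
  by apply: sectionD => //; exact: sectionZc.
apply: (metric_inj nondeg) => v.
have [e [he <-]] := extend_to_section sE (I : full E x v).
rewrite gDl (gZl _ a) (beta_sectionE x h12 ht he) (beta_sectionE x h1 ht he).
rewrite (beta_sectionE x h2 ht he).
rewrite (nabla_linear_r hn a (anchor_vector_field rho he) h1 h2).
rewrite !gDl !gZl; ring.
Qed.

Lemma beta_skew s t x : section C s -> section C t -> beta s t x = - beta t s x.
Proof.
move=> hs' ht; apply: (metric_inj nondeg) => v.
have [e [he <-]] := extend_to_section sE (I : full E x v).
rewrite gNl !beta_sectionE// [g x (s x) _]Defs.metric_sym [g x (t x) _]Defs.metric_sym.
ring.
Qed.

Lemma beta_leibniz s t (f : M -> R) x : section C s -> section C t -> smooth f ->
  beta s (fun y => f y *: t y) x = f x *: beta s t x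
    - g x (s x) (t x) *: partial_fun g rho (full E) f x.
Proof.
move=> hs' ht sf; have hft := sectionZ sC sf ht.
apply: (metric_inj nondeg) => v.
have [e [he <-]] := extend_to_section sE (I : full E x v).
rewrite gBl (gZl _ (f x)) (gZl _ (g x _ _)) partial_funE//.
rewrite (beta_sectionE x hs' ht he) (beta_sectionE x hs' hft he).
rewrite (nabla_leibniz hn sf (anchor_vector_field rho he) ht) gDr !gZr; ring.
Qed.

Notation pp e := (fun y => e y - projC (e y)).
Notation cc e := (fun y => projC (e y)).

(** A bracket of sections of [C] is killed by the anchor, so that only its
    [P]-component [beta] is prescribed; its [C]-component is taken to be 0. *)
Definition sum_bracket (e1 e2 : forall x, E x) x : E x :=
  B (pp e1) (pp e2) x + (nabla (vf e1) (cc e2) x - nabla (vf e2) (cc e1) x)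
  + beta (cc e1) (cc e2) x.

Lemma anchor_pp e : vf (pp e) = vf e.
Proof.
apply: functional_extensionality_dep => y.
by rewrite linearB /= (anchor_C (projC_in _)) subr0.
Qed.

Lemma section_nabla e s : section (full E) e -> section C s ->
  section C (nabla (vf e) s).
Proof. by move=> he; exact: (nabla_section hn (anchor_vector_field rho he)). Qed.

Section SumBracket.
Variables e1 e2 : forall x, E x.
Hypotheses (h1 : section (full E) e1) (h2 : section (full E) e2).

Let sigma y := nabla (vf e1) (cc e2) y - nabla (vf e2) (cc e1) y.

Lemma section_sigma : section C sigma.
Proof.
by apply: sectionB => //; apply: section_nabla => //; exact: section_projC.
Qed.

Lemma section_sumP : section P (fun y => B (pp e1) (pp e2) y + beta (cc e1) (cc e2) y).
Proof.
apply: sectionD => //.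
  by apply: (br_section hB); exact: section_projP.
by apply: section_beta; exact: section_projC.
Qed.

Lemma sum_bracketE x : sum_bracket e1 e2 x =
  (B (pp e1) (pp e2) x + beta (cc e1) (cc e2) x) + sigma x.
Proof. by rewrite /sum_bracket addrAC. Qed.

Lemma projC_sum_bracket : cc (sum_bracket e1 e2) = sigma.
Proof.
apply: functional_extensionality_dep => y; apply: projC_uniq.
  exact: section_sigma.2.
by rewrite sum_bracketE addrK; exact: section_sumP.2.
Qed.

Lemma projP_sum_bracket : pp (sum_bracket e1 e2) =
  fun y => B (pp e1) (pp e2) y + beta (cc e1) (cc e2) y.
Proof.
apply: functional_extensionality_dep => y.
have := congr1 (fun s : forall x, E x => s y) projC_sum_bracket => /= ->.
by rewrite sum_bracketE addrK.
Qed.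

Lemma section_sum_bracket : section (full E) (sum_bracket e1 e2).
Proof.
rewrite (_ : sum_bracket e1 e2 =
  fun y => (B (pp e1) (pp e2) y + beta (cc e1) (cc e2) y) + sigma y).
  by apply: sectionD => //; [exact: section_full section_sumP|
    exact: section_full section_sigma].
by apply: functional_extensionality_dep => y; exact: sum_bracketE.
Qed.

Lemma anchor_sum_bracket : vf (sum_bracket e1 e2) = lie_bracket (vf e1) (vf e2).
Proof.
apply: functional_extensionality_dep => y; rewrite sum_bracketE linearD /=.
rewrite (anchor_C (section_sigma.2 y)) addr0 linearD /=.
rewrite [rho y (beta _ _ _)](anchor_partial_im nondeg isot).
  rewrite addr0 (br_anchor hB (section_projP h1) (section_projP h2)).
  by have := anchor_pp e1 => /= ->; have := anchor_pp e2 => /= ->.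
by apply: beta_im; exact: section_projC.
Qed.

Lemma metric_sum_bracket e3 x : section (full E) e3 ->
  g x (sum_bracket e1 e2 x) (e3 x) =
  g x (B (pp e1) (pp e2) x) (e3 x - projC (e3 x))
  + (g x (nabla (vf e1) (cc e2) x) (projC (e3 x))
     - g x (nabla (vf e2) (cc e1) x) (projC (e3 x)))
  + 2^-1 * (g x (nabla (vf e3) (cc e1) x) (projC (e2 x))
     - g x (projC (e1 x)) (nabla (vf e3) (cc e2) x)).
Proof.
move=> h3; have [c1 c2] := (section_projC h1, section_projC h2).
rewrite sum_bracketE gDl (gDl _ (B _ _ _)) (beta_sectionE x c1 c2 h3).
have -> : g x (B (pp e1) (pp e2) x) (e3 x) =
    g x (B (pp e1) (pp e2) x) (e3 x - projC (e3 x)).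
  rewrite gBr [X in _ = _ - X]metric_PC ?subr0//; last exact: projC_in.
  by apply: (br_section hB _ _).2; exact: section_projP.
have -> : g x (sigma x) (e3 x) = g x (sigma x) (projC (e3 x)).
  rewrite -{1}(subrK (projC (e3 x)) (e3 x)) gDr metric_CP ?add0r//.
    exact: projC_P.
  exact: section_sigma.2.
rewrite /sigma gBl; ring.
Qed.

End SumBracket.

Lemma metric_split x (u v : E x) :
  g x u v = g x (u - projC u) (v - projC v) + g x (projC u) (projC v).
Proof.
have [c1 c2] := (projC_in u, projC_in v); have [p1 p2] := (projC_P u, projC_P v).
rewrite -{1}(subrK (projC u) u) -{1}(subrK (projC v) v).
set p := u - _ in p1 *; set q := v - _ in p2 *.
by rewrite gDl (gDr _ p q) (gDr _ _ q) (metric_PC p1 c2) (metric_CP p2 c1) addr0 add0r.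
Qed.

Lemma projC_scale x (a : R) (u : E x) : projC (a *: u) = a *: projC u.
Proof.
have := projC_lin a u 0.
by rewrite !addr0 [projC (0 : E x)](projC_eq0 (P0 x)) addr0.
Qed.

Lemma sum_bracket_linear a e1 e2 e x : section (full E) e1 -> section (full E) e2 ->
  section (full E) e -> sum_bracket (fun y => a *: e1 y + e2 y) e x =
  a *: sum_bracket e1 e x + sum_bracket e2 e x.
Proof.
move=> h1 h2 h.
have [v1 v2 v] := And3 (anchor_vector_field rho h1) (anchor_vector_field rho h2)
  (anchor_vector_field rho h).
have [c1 c2 c] := And3 (section_projC h1) (section_projC h2) (section_projC h).
have -> : sum_bracket (fun y => a *: e1 y + e2 y) e x =
    B (fun y => a *: (e1 y - projC (e1 y)) + (e2 y - projC (e2 y))) (pp e) x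
    + (nabla (fun y => a *: rho y (e1 y) + rho y (e2 y)) (cc e) x
       - nabla (vf e) (fun y => a *: projC (e1 y) + projC (e2 y)) x)
    + beta (fun y => a *: projC (e1 y) + projC (e2 y)) (cc e) x.
  rewrite /sum_bracket.
  congr (B _ _ _ + (nabla _ _ _ - nabla _ _ _) + beta _ _ _);
    apply: functional_extensionality_dep => y.
  - by rewrite projC_lin opprD addrACA scalerBr.
  - by rewrite linearP.
  - by rewrite projC_lin.
  - by rewrite projC_lin.
rewrite (br_linear hB a (section_projP h1) (section_projP h2) (section_projP h)).
rewrite (nabla_linear_l hn (smooth_cst a) v1 v2 c) (nabla_linear_r hn a v c1 c2).
rewrite (beta_linl x a c1 c2 c) /sum_bracket.
set b1 := B _ _ _; set b2 := B _ _ _; set n1 := nabla _ _ _; set n2 := nabla _ _ _.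
set n3 := nabla _ _ _; set n4 := nabla _ _ _.
set be1 := beta _ _ _; set be2 := beta _ _ _.
apply: (metric_inj nondeg) => w; rewrite !(gDl, gNl, gZl _ a); ring.
Qed.

Lemma sum_bracket_skew e1 e2 x : section (full E) e1 -> section (full E) e2 ->
  sum_bracket e1 e2 x = - sum_bracket e2 e1 x.
Proof.
move=> h1 h2; rewrite /sum_bracket (br_skew hB (section_projP h1) (section_projP h2)).
by rewrite (beta_skew x (section_projC h1) (section_projC h2)) !opprD opprK
  [- _ + nabla _ _ _]addrC.
Qed.

Lemma sum_bracket_leibniz e1 e2 (f : M -> R) x : section (full E) e1 ->
  section (full E) e2 -> smooth f ->
  sum_bracket e1 (fun y => f y *: e2 y) x =
    f x *: sum_bracket e1 e2 x + rho x (e1 x) f *: e2 x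
    - g x (e1 x) (e2 x) *: partial_fun g rho (full E) f x.
Proof.
move=> h1 h2 sf.
have [v1 v2] := (anchor_vector_field rho h1, anchor_vector_field rho h2).
have [c1 c2] := (section_projC h1, section_projC h2).
have [p1 p2] := (section_projP h1, section_projP h2).
have -> : sum_bracket e1 (fun y => f y *: e2 y) x =
    B (pp e1) (fun y => f y *: (e2 y - projC (e2 y))) x
    + (nabla (vf e1) (fun y => f y *: projC (e2 y)) x
       - nabla (fun y => f y *: rho y (e2 y) + 0) (cc e1) x)
    + beta (cc e1) (fun y => f y *: projC (e2 y)) x.
  rewrite /sum_bracket.
  congr (B _ _ _ + (nabla _ _ _ - nabla _ _ _) + beta _ _ _);
    apply: functional_extensionality_dep => y.
  - by rewrite projC_scale scalerBr.
  - by rewrite projC_scale.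
  - by rewrite linearZ addr0.
  - by rewrite projC_scale.
rewrite (br_leibniz hB p1 p2 sf) (nabla_leibniz hn sf v1 c2).
rewrite (nabla_linear_l hn sf v2 vector_field0 c1) nabla0l// (beta_leibniz x c1 c2 sf).
rewrite partial_fun_P /sum_bracket.
have -> : rho x (e1 x - projC (e1 x)) = rho x (e1 x).
  by rewrite linearB /= (anchor_C (projC_in _)) subr0.
have -> : g x (e1 x) (e2 x) = g x (e1 x - projC (e1 x)) (e2 x - projC (e2 x)) +
    g x (projC (e1 x)) (projC (e2 x)).
  exact: metric_split.
move: (g x (e1 x - _) _) (g x (projC _) (projC _)) => k1 k2.
apply: (metric_inj nondeg) => w.
set b := B _ _ _; set n1 := nabla _ _ _; set n2 := nabla _ _ _.
set be := beta _ _ _; set df := partial_fun _ _ _ _ _.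
rewrite !(gDl, gNl, g0l, gZl _ (f x), gZl _ (rho x (e1 x) f)).
rewrite !(gZl _ k1, gZl _ k2, gZl _ (k1 + k2)); ring.
Qed.

Lemma anchor_projP x (u : E x) : rho x (u - projC u) = rho x u.
Proof. by rewrite linearB /= (anchor_C (projC_in _)) subr0. Qed.

Lemma derive_metric_split e1 e2 x (v : tangent x) :
  section (full E) e1 -> section (full E) e2 ->
  v (fun y => g y (e1 y) (e2 y)) =
  v (fun y => g y (e1 y - projC (e1 y)) (e2 y - projC (e2 y))) +
  v (fun y => g y (projC (e1 y)) (projC (e2 y))).
Proof.
move=> h1 h2; rewrite -tangent_add.
- by congr (v _); apply/funext => y; exact: metric_split.
- exact: smooth_metric_section (section_projP h1) (section_projP h2).
- exact: smooth_metric_section (section_projC h1) (section_projC h2).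
Qed.

Lemma derive_metric_C X s t x : vector_field X -> section C s -> section C t ->
  X x (fun y => g y (s y) (t y)) =
  g x (nabla X s x) (t x) + g x (nabla X t x) (s x).
Proof.
by move=> vX hs' ht; rewrite (nabla_metric hn vX hs' ht) [g x (s x) _]Defs.metric_sym.
Qed.

Lemma sum_bracket_metric e e1 e2 x : section (full E) e -> section (full E) e1 ->
  section (full E) e2 ->
  rho x (e x) (fun y => g y (e1 y) (e2 y)) =
    g x (sum_bracket e e1 x
      + partial_fun g rho (full E) (fun y => g y (e y) (e1 y)) x) (e2 x)
    + g x (e1 x) (sum_bracket e e2 x
      + partial_fun g rho (full E) (fun y => g y (e y) (e2 y)) x).
Proof.
move=> h h1 h2.
have [v1 v2 v] := And3 (anchor_vector_field rho h1) (anchor_vector_field rho h2)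
  (anchor_vector_field rho h).
have [c1 c2 c] := And3 (section_projC h1) (section_projC h2) (section_projC h).
rewrite [g x (e1 x) _]Defs.metric_sym !(gDl _ (sum_bracket _ _ _)).
rewrite !partial_funE// (metric_sum_bracket h h1 x h2) (metric_sum_bracket h h2 x h1).
rewrite (derive_metric_split _ h1 h2) (derive_metric_split _ h h1).
rewrite (derive_metric_split _ h h2).
have /= := br_metric hB (section_projP h) (section_projP h1) (section_projP h2) x.
rewrite anchor_projP => ->.
rewrite [g x (e1 x - _) _]Defs.metric_sym !(gDl _ (B _ _ _)) !partial_fun_P.
rewrite !partial_funE// !anchor_projP.
rewrite (derive_metric_C x v c1 c2) (derive_metric_C x v2 c c1)
  (derive_metric_C x v1 c c2).
rewrite ![g x (projC (e x)) _]Defs.metric_sym.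
by field.
Qed.

(** Tested against a fourth section, the Jacobi identity becomes a linear relation
    between the numbers [nabla2] and [nabla11]. *)
Definition nabla2 e e' s t x : R :=
  g x (nabla (vf e) (nabla (vf e') s) x) (t x).
Definition nabla11 e s e' t x : R :=
  g x (nabla (vf e) s x) (nabla (vf e') t x).

Lemma nabla_sub X s t x : vector_field X -> section C s -> section C t ->
  nabla X (fun y => s y - t y) x = nabla X s x - nabla X t x.
Proof.
move=> vX hs' ht.
have := nabla_linear_r hn (-1) vX ht hs' x; rewrite scaleN1r addrC => <-.
by congr (nabla X _ x); apply: functional_extensionality_dep => y;
  rewrite scaleN1r addrC.
Qed.

Lemma nabla_lie X Y s x : vector_field X -> vector_field Y -> section C s ->
  nabla (lie_bracket X Y) s x = nabla X (nabla Y s) x - nabla Y (nabla X s) x.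
Proof. by move=> vX vY hs'; have /subr0_eq -> := nabla_flat hn vX vY hs' x. Qed.

Lemma derive_nabla e e' s t x : section (full E) e -> section (full E) e' ->
  section C s -> section C t ->
  rho x (e x) (fun y => g y (nabla (vf e') s y) (t y)) =
  nabla2 e e' s t x + nabla11 e t e' s x.
Proof.
move=> he he' hs' ht.
exact: derive_metric_C (anchor_vector_field rho he) (section_nabla he' hs') ht.
Qed.

Lemma smooth_nabla_metric e s t : section (full E) e -> section C s ->
  section C t -> smooth (fun y => g y (nabla (vf e) s y) (t y)).
Proof.
move=> he hs' ht; exact: smooth_metric_section (section_nabla he hs') ht.
Qed.

Lemma derive_omega e e' s t x : section (full E) e -> section (full E) e' ->
  section C s -> section C t ->
  rho x (e x) (fun y => 2^-1 *
    (g y (nabla (vf e') s y) (t y) - g y (nabla (vf e') t y) (s y))) =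
  2^-1 * (nabla2 e e' s t x + nabla11 e t e' s x
          - (nabla2 e e' t s x + nabla11 e s e' t x)).
Proof.
move=> he he' hs' ht.
have [s1 s2] := (smooth_nabla_metric he' hs' ht, smooth_nabla_metric he' ht hs').
rewrite tangent_scale ?tangent_sub ?derive_nabla//.
exact: smoothB.
Qed.

Lemma beta_omega s t e x : section C s -> section C t -> section (full E) e ->
  g x (beta s t x) (e x) =
  2^-1 * (g x (nabla (vf e) s x) (t x) - g x (nabla (vf e) t x) (s x)).
Proof.
by move=> hs' ht he; rewrite beta_sectionE// [g x (s x) _]Defs.metric_sym.
Qed.

(** Brackets with sections of the image of the coboundary are computed by the
    metric axiom for [B]: such a section pairs with [e] through the 1-form
    [omega], evaluated on the anchor of [e]. *)
Lemma metric_bracket_beta s t e3 e4 x : section C s -> section C t ->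
  section (full E) e3 -> section (full E) e4 ->
  g x (B (beta s t) (pp e3) x) (e4 x - projC (e4 x)) =
  4^-1 * (nabla2 e4 e3 t s x - nabla2 e4 e3 s t x)
  + 3 / 4 * (nabla11 e4 t e3 s x - nabla11 e4 s e3 t x).
Proof.
move=> hs' ht h3 h4; have [p3 p4] := (section_projP h3, section_projP h4).
have hb := section_beta hs' ht.
rewrite (br_skew hB hb p3) gNl.
have /= := br_metric hB p3 hb p4 x; rewrite anchor_projP.
have b_fun e : section (full E) e ->
    (fun y => g y (beta s t y) (e y - projC (e y))) = fun y => 2^-1 *
      (g y (nabla (vf e) s y) (t y) - g y (nabla (vf e) t y) (s y)).
  move=> he; apply/funext => y.
  have := beta_omega y hs' ht (section_full (section_projP he)).
  by rewrite anchor_pp.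
rewrite (b_fun _ h4) (derive_omega x h3 h4 hs' ht).
rewrite !partial_fun_P (gDl _ (B _ _ _)) (gDr _ _ (B _ _ _)) partial_funE//.
rewrite anchor_projP.
have -> : (fun y => g y (e3 y - projC (e3 y)) (beta s t y)) = fun y => 2^-1 *
      (g y (nabla (vf e3) s y) (t y) - g y (nabla (vf e3) t y) (s y)).
  by rewrite -b_fun//; apply/funext => y; exact: Defs.metric_sym.
rewrite (derive_omega x h4 h3 hs' ht).
rewrite (isot (beta_im x hs' ht) (partial_fun_im _ _ _ _)) addr0.
rewrite (beta_omega x hs' ht (section_full (br_section hB p3 p4))).
have -> : vf (B (pp e3) (pp e4)) = lie_bracket (vf e3) (vf e4).
  apply: functional_extensionality_dep => y; rewrite (br_anchor hB p3 p4).
  by have := anchor_pp e3 => /= ->; have := anchor_pp e4 => /= ->.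
have [v3 v4] := (anchor_vector_field rho h3, anchor_vector_field rho h4).
rewrite !(nabla_lie x v3 v4)// !gBl -!/(nabla2 _ _ _ _ x).
have -> : nabla11 e3 t e4 s x = nabla11 e4 s e3 t x by exact: Defs.metric_sym.
have -> : nabla11 e3 s e4 t x = nabla11 e4 t e3 s x by exact: Defs.metric_sym.
by lra.
Qed.

Definition jacobi_rest e1 e2 e3 e4 x : R :=
  let s1 := cc e1 in let s2 := cc e2 in let s3 := cc e3 in let s4 := cc e4 in
  4^-1 * (nabla2 e4 e3 s2 s1 x - nabla2 e4 e3 s1 s2 x)
  + 3 / 4 * (nabla11 e4 s2 e3 s1 x - nabla11 e4 s1 e3 s2 x)
  + (nabla2 e1 e2 s3 s4 x - nabla2 e2 e1 s3 s4 x
     - (nabla2 e3 e1 s2 s4 x - nabla2 e3 e2 s1 s4 x))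
  + 2^-1 * (nabla2 e4 e1 s2 s3 x - nabla2 e4 e2 s1 s3 x
     - (nabla11 e4 s3 e1 s2 x - nabla11 e4 s3 e2 s1 x)).

(** The coefficients 1/4 and 3/4 come from [metric_bracket_beta], the second
    differences from flatness, and the factor 1/2 from the definition of [beta]. *)
Lemma metric_double_bracket e1 e2 e3 e4 x : section (full E) e1 ->
  section (full E) e2 -> section (full E) e3 -> section (full E) e4 ->
  g x (sum_bracket (sum_bracket e1 e2) e3 x) (e4 x) =
  g x (B (B (pp e1) (pp e2)) (pp e3) x) (e4 x - projC (e4 x))
  + jacobi_rest e1 e2 e3 e4 x.
Proof.
move=> h1 h2 h3 h4; have h12 := section_sum_bracket h1 h2.
have [v1 v2] := (anchor_vector_field rho h1, anchor_vector_field rho h2).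
have [v3 v4] := (anchor_vector_field rho h3, anchor_vector_field rho h4).
have [c1 c2] := (section_projC h1, section_projC h2).
have [c3 c4] := (section_projC h3, section_projC h4).
have [n12 n21] := (section_nabla h1 c2, section_nabla h2 c1).
rewrite (metric_sum_bracket h12 h3 x h4).
have cE y : projC (sum_bracket e1 e2 y) =
    nabla (vf e1) (cc e2) y - nabla (vf e2) (cc e1) y.
  exact: (congr1 (fun s : forall x, E x => s y) (projC_sum_bracket h1 h2)).
rewrite (projC_sum_bracket h1 h2) (projP_sum_bracket h1 h2) (anchor_sum_bracket h1 h2).
rewrite (bracket_addl hB); last exact: section_projP.
- rewrite gDl (metric_bracket_beta x c1 c2 h3 h4) cE.
  rewrite (nabla_lie x v1 v2 c3) (nabla_sub x v3 n12 n21) (nabla_sub x v4 n12 n21).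
  rewrite !gBl -!/(nabla2 _ _ _ _ x).
  rewrite [g x (nabla (vf e1) (cc e2) x) _]Defs.metric_sym.
  rewrite [g x (nabla (vf e2) (cc e1) x) _]Defs.metric_sym.
  by rewrite -!/(nabla11 _ _ _ _ x) /jacobi_rest; lra.
- by apply: (br_section hB); exact: section_projP.
- exact: section_beta.
Qed.

Lemma derive_metric_sum_bracket e1 e2 e3 e4 x : section (full E) e1 ->
  section (full E) e2 -> section (full E) e3 -> section (full E) e4 ->
  let s1 := cc e1 in let s2 := cc e2 in let s3 := cc e3 in
  smooth (fun y => g y (sum_bracket e1 e2 y) (e3 y)) /\
  rho x (e4 x) (fun y => g y (sum_bracket e1 e2 y) (e3 y)) =
  rho x (e4 x) (fun y => g y (B (pp e1) (pp e2) y) (e3 y - projC (e3 y)))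
  + (nabla2 e4 e1 s2 s3 x + nabla11 e4 s3 e1 s2 x
     - (nabla2 e4 e2 s1 s3 x + nabla11 e4 s3 e2 s1 x))
  + 2^-1 * (nabla2 e4 e3 s1 s2 x + nabla11 e4 s2 e3 s1 x
     - (nabla2 e4 e3 s2 s1 x + nabla11 e4 s1 e3 s2 x)).
Proof.
move=> h1 h2 h3 h4 s1 s2 s3.
have [c1 c2 c3] := And3 (section_projC h1) (section_projC h2) (section_projC h3).
split; first exact: smooth_metric_section (section_sum_bracket h1 h2) h3.
have [p1 p2 p3] := And3 (section_projP h1) (section_projP h2) (section_projP h3).
have sB := smooth_metric_section g (br_section hB p1 p2) p3.
have [n1 n2] := (smooth_nabla_metric h1 c2 c3, smooth_nabla_metric h2 c1 c3).
have [n3 n4] := (smooth_nabla_metric h3 c1 c2, smooth_nabla_metric h3 c2 c1).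
rewrite -(derive_omega x h4 h3 c1 c2).
rewrite -(derive_nabla x h4 h1 c2 c3) -(derive_nabla x h4 h2 c1 c3).
rewrite -tangent_sub// -tangent_add//; last exact: smoothB.
rewrite -tangent_add; [|by apply: smoothD => //; exact: smoothB|]; last first.
  by apply: (smoothM (smooth_cst 2^-1)); exact: smoothB.
congr (rho x _ _); apply/funext => y.
by rewrite (metric_sum_bracket h1 h2 y h3) [g y (projC (e1 y)) _]Defs.metric_sym.
Qed.

(** The terms in [B] satisfy the Jacobi identity of [P].  In the cyclic sum of the
    others, the derivatives [nabla2] along [e1], [e2], [e3] that are paired with
    [e4] cancel by flatness, already used in [metric_double_bracket]; the terms
    that are derived along [e4] add up to a quarter of the derivative of the
    cyclic sum of [omega], on both sides. *)
Lemma sum_bracket_jacobi e1 e2 e3 x : section (full E) e1 ->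
  section (full E) e2 -> section (full E) e3 ->
  sum_bracket (sum_bracket e1 e2) e3 x + sum_bracket (sum_bracket e2 e3) e1 x
  + sum_bracket (sum_bracket e3 e1) e2 x =
  3^-1 *: partial_fun g rho (full E) (fun y =>
    g y (sum_bracket e1 e2 y) (e3 y) + g y (sum_bracket e2 e3 y) (e1 y)
    + g y (sum_bracket e3 e1 y) (e2 y)) x.
Proof.
move=> h1 h2 h3; apply: (metric_inj nondeg) => v.
have [e4 [h4 <-]] := extend_to_section sE (I : full E x v).
rewrite (gDl _ (sum_bracket _ _ _ + _)) (gDl _ (sum_bracket _ _ _)).
rewrite !metric_double_bracket// (gZl _ 3^-1) partial_funE//.
have [s12 d12] := derive_metric_sum_bracket x h1 h2 h3 h4.
have [s23 d23] := derive_metric_sum_bracket x h2 h3 h1 h4.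
have [s31 d31] := derive_metric_sum_bracket x h3 h1 h2 h4.
rewrite tangent_add//; last exact: smoothD.
rewrite tangent_add// d12 d23 d31.
have [p1 p2 p3] := And3 (section_projP h1) (section_projP h2) (section_projP h3).
have /= := congr1 (fun u : E x => g x u (e4 x - projC (e4 x)))
  (br_jacobi hB p1 p2 p3 x).
rewrite (gDl _ (B _ _ _ + _)) (gDl _ (B _ _ _)) (gZl _ 3^-1).
rewrite partial_fun_P partial_funE// anchor_projP.
have sB12 := smooth_metric_section g (br_section hB p1 p2) p3.
have sB23 := smooth_metric_section g (br_section hB p2 p3) p1.
have sB31 := smooth_metric_section g (br_section hB p3 p1) p2.
rewrite tangent_add//; last exact: smoothD.
rewrite tangent_add// /jacobi_rest.
by lra.
Qed.

Lemma sum_bracket_courant : courant_bracket g rho (full E) sum_bracket.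
Proof.
split.
- by move=> e1 e2; exact: section_sum_bracket.
- by move=> a e1 e2 e h1 h2 h x; exact: sum_bracket_linear.
- by move=> e1 e2 h1 h2 x; exact: sum_bracket_skew.
- move=> e1 e2 h1 h2 x.
  exact: (congr1 (fun X : forall x, tangent x => X x) (anchor_sum_bracket h1 h2)).
- by move=> x alpha; apply: (anchor_partial_im nondeg isot); exists alpha.
- by move=> e1 e2 e3 h1 h2 h3 x; exact: sum_bracket_jacobi.
- by move=> e1 e2 f h1 h2 sf x; exact: sum_bracket_leibniz.
- by move=> e e1 e2 h h1 h2 x; exact: sum_bracket_metric.
Qed.

Lemma sum_bracket_P e1 e2 : section P e1 -> section P e2 ->
  section P (sum_bracket e1 e2).
Proof.
move=> h1 h2; have [f1 f2] := (section_full h1, section_full h2).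
have cc0 e : section P e -> cc e = fun=> 0.
  move=> [_ Pe]; apply: functional_extensionality_dep => y; exact: projC_eq0.
have := projC_sum_bracket f1 f2; rewrite (cc0 _ h1) (cc0 _ h2) => sb0.
have [sse _] := section_sum_bracket f1 f2; split=> // x.
have n0 e : section (full E) e -> nabla (vf e) (fun=> 0) x = 0.
  move=> he; have c0 := section0 sC.
  have := nabla_sub x (anchor_vector_field rho he) c0 c0; rewrite subrr => <-.
  by congr (nabla _ _ x); apply: functional_extensionality_dep => y; rewrite subrr.
have := congr1 (fun s : forall x, E x => s x) sb0 => /=; rewrite !n0// subrr => c0.
by have := projC_P (sum_bracket e1 e2 x); rewrite c0 subr0.
Qed.

End ConnectionToBracket.

End Splitting.

Theorem corollary3p1 (R : realType) (M : manifold R) (E : vector_bundle M)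
    (g : metric E) (rho : anchor E)
    (hE : courant_vector_bundle g rho (full E))
    (hrho : surjective_anchor rho) :
  has_restricted_courant_structure g rho <->
  exists Q C : subfamily E,
    [/\ splitting g rho Q C,
        courant_algebroid g rho (extension g rho Q),
        neutral g (extension g rho Q)
      & flat_pseudo_euclidean g C].
Proof.
split=> [[br [hbr [Q [C [hs hcl]]]]]|].
  exists Q, C; split=> //; last 2 first.
  - exact: (P_neutral hE hrho hs).
  - split; first exact: (C_pseudo_euclidean hE hs).
    by eexists; exact: (bracket_connection hE hrho hs hbr hcl).
  split; first exact: (P_courant_vector_bundle hE hs).
  by exists br; exact: (bracket_restrict hE hs hbr hcl).
move=> [Q [C [hs [_ [B hB]] _ [_ [nabla hn]]]]].
exists (sum_bracket (Q := Q) (C := C) hE hrho B nabla); split.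
  exact: sum_bracket_courant.
by exists Q, C; split=> // e1 e2; exact: sum_bracket_P.
Qed.
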